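(* Let $N\ge 1$, let $\omega_1,\dots,\omega_N\in\mathbb{R}$ and let $\kappa>0$ satisfy \[ \kappa>2\max_{i=1,\dots,N}|\omega_i|. \] For initial data $(\theta_1^0,\dots,\theta_N^0)\in\mathbb{R}^N$ let $(\theta_1(t),\dots,\theta_N(t))$ be the solution of \[ \dot\theta_i(t)=\omega_i-\frac{\kappa}{N}\sum_{j=1}^N\big(1+\cos\theta_j(t)\big)\sin\theta_i(t),\quad t>0,\qquad \theta_i(0)=\theta_i^0,\quad i=1,\dots,N, \] and let $R(t)=\frac1N\sum_{j=1}^N(1+\cos\theta_j(t))$. Then for Lebesgue almost every initial data $(\theta_i^0)_{i=1}^N\in\mathbb{R}^N$ the following hold: (a) for every $i=1,\dots,N$ the limit $\lim_{t\to\infty}\theta_i(t)$ exists and $\lim_{t\to\infty}\dot\theta_i(t)=0$; (b) the limit $R_\infty:=\lim_{t\to\infty}R(t)$ exists and \[ R_\infty\ge\sqrt{\frac12+\sqrt{\frac14-\frac{\max_i|\omega_i|^2}{\kappa^2}}}. \]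
   Context: The ODE is the (sinusoidal) Winfree model; $R$ is its order parameter. Solutions exist globally and are unique. *)

(* Defs.v *)
From Stdlib Require Import Reals.
From Coquelicot Require Import Coquelicot.
Open Scope R_scope.

Fixpoint rsum (N : nat) (f : nat -> R) : R :=
  match N with O => 0 | S n => rsum n f + f n end.

Fixpoint rprod (N : nat) (f : nat -> R) : R :=
  match N with O => 1 | S n => rprod n f * f n end.

Fixpoint rmaxabs (N : nat) (w : nat -> R) : R :=
  match N with O => 0 | S n => Rmax (rmaxabs n w) (Rabs (w n)) end.

(* A point of R^N is represented by x : nat -> R, only coordinates i < N matter.
   lebesgue_null N E : E has N-dimensional Lebesgue (outer) measure zero, i.e.
   for every eps > 0 it is covered by countably many closed boxes
   prod_{i<N} [a k i, b k i] of total volume <= eps. *)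
Definition lebesgue_null (N : nat) (E : (nat -> R) -> Prop) : Prop :=
  forall eps : R, 0 < eps ->
  exists a b : nat -> nat -> R,
    (forall k i, (i < N)%nat -> a k i <= b k i) /\
    (forall x, E x -> exists k, forall i, (i < N)%nat -> a k i <= x i <= b k i) /\
    (forall K, rsum K (fun k => rprod N (fun i => b k i - a k i)) <= eps).

Definition winfree_rhs (N : nat) (omega : nat -> R) (kappa : R)
  (th : nat -> R) (i : nat) : R :=
  omega i - kappa / INR N * rsum N (fun j => 1 + cos (th j)) * sin (th i).

Definition order_param (N : nat) (th : nat -> R) : R :=
  / INR N * rsum N (fun j => 1 + cos (th j)).

Definition winfree_solution (N : nat) (omega : nat -> R) (kappa : R)
  (x : nat -> R) (theta : R -> nat -> R) : Prop :=
  (forall i, (i < N)%nat -> theta 0 i = x i) /\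
  (forall i, (i < N)%nat ->
      filterlim (fun t => theta t i) (at_right 0) (locally (x i))) /\
  (forall t, 0 < t -> forall i, (i < N)%nat ->
      is_derive (fun s => theta s i) t (winfree_rhs N omega kappa (theta t) i)).

(* Main.v *)
Require Import Defs.
From Stdlib Require Import Reals Lra Lia List ZArith Classical Arith IndefiniteDescription.
From Coquelicot Require Import Coquelicot.
Open Scope R_scope.
Import ListNotations.

(** The divergence of the Winfree field is
    [kappa/N * sum sin^2 theta_j + kappa N R (1 - R)], so the flow expands volume where [R <= 1].
    The data whose solution has [R <= 1] for all time form a forward invariant, [2 pi]-periodic
    set; since the torus has finite volume, this set is null.

    Any other solution has [R > 1] at some time [t0].  Let [c] be the claimed lower bound and
    [M = max |omega_i|]; then [c^2 (1 - c^2) = M^2/kappa^2], so [cos theta_i] is nondecreasing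
    as long as [R >= c] and [|cos theta_i| <= c].  Hence
    [cos theta_i t >= cos theta_i t0 - (1 - c)], and averaging gives [R > c] from [t0] on.

    From then on each angle is trapped in a bounded interval, so the potential of the gradient
    flow is bounded and all speeds tend to 0.  Eventually [sin^2 theta_i <= 1/2], and comparing
    [kappa R sin theta_i = omega_i - theta_i'] at two times yields
    [|Delta R| <= (2 M / kappa) |Delta R| + o(1)].  Since [2 M < kappa], [R] and the angles
    converge. *)

(** * Finite covers by boxes *)

(** On [R <= 1] the divergence is only nonnegative: it vanishes where all sines are 0 and [R] is 0
    or 1. Expansion is therefore measured by [sin^2] of angle 0 alone, and the data for which that
    sine is 0 lie on hyperplanes that are covered directly.

    The volume argument works with finite lists of boxes and pairs of trajectories, not with a flow
    map and its Jacobian. Pulling a box back by a short time [h] turns expansion into contraction.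
    The set of data with [R <= 1] forever is not assumed measurable; its size is the infimum of the
    volumes of its finite covers. This infimum is never computed: near-optimality of a cover already
    forces the boxes that contract at a definite rate to have small total volume.

    The constant [c] is the level at which the two conditions close up: for [R = c] and
    [|cos theta_i| = c] the damping [kappa R |sin theta_i|] equals [M]. A cosine can then only fall
    from 1 to [c], and the loss [1 - c] is exactly what separates [R > 1] from [R > c]. *)

Lemma rsum_ext n f g : (forall i, (i < n)%nat -> f i = g i) -> rsum n f = rsum n g.
Proof. induction n; simpl; intros H; auto. rewrite IHn, H; auto. Qed.

Lemma rsum_le n f g : (forall i, (i < n)%nat -> f i <= g i) -> rsum n f <= rsum n g.
Proof.
  induction n; simpl; intros H; [lra|].
  apply Rplus_le_compat; auto.
Qed.

Lemma rsum_nonneg n f : (forall i, (i < n)%nat -> 0 <= f i) -> 0 <= rsum n f.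
Proof.
  induction n; simpl; intros H; [lra|].
  apply Rplus_le_le_0_compat; auto.
Qed.

Lemma rsum_plus n f g : rsum n (fun i => f i + g i) = rsum n f + rsum n g.
Proof. induction n; simpl; [|rewrite IHn]; ring. Qed.

Lemma rsum_scal n a f : rsum n (fun i => a * f i) = a * rsum n f.
Proof. induction n; simpl; [|rewrite IHn]; ring. Qed.

Lemma rsum_const n a : rsum n (fun _ => a) = INR n * a.
Proof. induction n; [simpl; ring|]. rewrite S_INR; simpl rsum. rewrite IHn; ring. Qed.

Lemma rsum_minus n f g : rsum n (fun i => f i - g i) = rsum n f - rsum n g.
Proof. induction n; simpl; [|rewrite IHn]; ring. Qed.

Lemma rsum_abs n f : Rabs (rsum n f) <= rsum n (fun i => Rabs (f i)).
Proof.
  induction n; simpl; [rewrite Rabs_R0; lra|].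
  eapply Rle_trans; [apply Rabs_triang|lra].
Qed.

Lemma rsum_term n f i :
  (forall j, (j < n)%nat -> 0 <= f j) -> (i < n)%nat -> f i <= rsum n f.
Proof.
  induction n; simpl; intros H Hi; [lia|].
  destruct (Nat.eq_dec i n) as [->|].
  - assert (0 <= rsum n f) by (apply rsum_nonneg; auto). lra.
  - assert (f i <= rsum n f) by (apply IHn; auto; lia).
    assert (0 <= f n) by auto. lra.
Qed.

Lemma rprod_ext n f g : (forall i, (i < n)%nat -> f i = g i) -> rprod n f = rprod n g.
Proof. induction n; simpl; intros H; auto. rewrite IHn, H; auto. Qed.

Lemma rprod_pos n f : (forall i, (i < n)%nat -> 0 < f i) -> 0 < rprod n f.
Proof.
  induction n; simpl; intros H; [lra|].
  apply Rmult_lt_0_compat; auto.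
Qed.

Definition upd (f : nat -> R) (i : nat) (v : R) : nat -> R :=
  fun j => if Nat.eq_dec j i then v else f j.

Lemma upd_same f i v : upd f i v i = v.
Proof. unfold upd; destruct Nat.eq_dec; congruence. Qed.

Lemma upd_other f i v j : j <> i -> upd f i v j = f j.
Proof. unfold upd; destruct Nat.eq_dec; congruence. Qed.

Lemma rprod_upd_scal n f i c : (i < n)%nat -> rprod n (upd f i (c * f i)) = c * rprod n f.
Proof.
  induction n; intros Hi; [lia|]. simpl.
  destruct (Nat.eq_dec i n) as [->|Hn].
  - rewrite upd_same, (rprod_ext n (upd f n _) f); [ring|].
    intros j Hj; apply upd_other; lia.
  - rewrite (upd_other f i _ n) by auto. rewrite IHn by lia. ring.
Qed.

(** Turns a product of diagonal factors into their trace. The constant [K] depends only on [n] and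
    [B], so the error is of second order uniformly over all boxes. *)
Lemma rprod_expand n B : 0 <= B -> exists K, 0 <= K /\
  forall h u, 0 <= h <= 1 -> (forall i, (i < n)%nat -> Rabs (u i) <= B) ->
  Rabs (rprod n (fun i => 1 + h * u i) - 1 - h * rsum n u) <= K * h ^ 2.
Proof.
  intros HB; induction n as [|n [K [HK IH]]].
  - exists 0; split; [lra|]. intros h u _ _; simpl.
    replace (1 - 1 - h * 0) with 0 by ring. rewrite Rabs_R0; lra.
  - exists (K * (1 + B) + INR n * B * B). split.
    { assert (0 <= INR n) by apply pos_INR.
      assert (0 <= K * (1 + B)) by (apply Rmult_le_pos; lra).
      assert (0 <= INR n * B * B) by (repeat apply Rmult_le_pos; lra). lra. }
    intros h u Hh Hu. simpl rprod; simpl rsum.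
    set (P := rprod n _). set (S := rsum n u).
    specialize (IH h u Hh (fun i Hi => Hu i (Nat.lt_lt_succ_r _ _ Hi))).
    fold P S in IH.
    replace (P * (1 + h * u n) - 1 - h * (S + u n))
      with ((P - 1 - h * S) * (1 + h * u n) + h ^ 2 * (S * u n)) by ring.
    assert (Hun : Rabs (u n) <= B) by (apply Hu; lia).
    assert (HS : Rabs S <= INR n * B).
    { eapply Rle_trans; [apply rsum_abs|]. rewrite <- rsum_const.
      apply rsum_le; intros; apply Hu; lia. }
    eapply Rle_trans; [apply Rabs_triang|]. rewrite !Rabs_mult.
    rewrite (Rabs_pos_eq (h ^ 2)) by apply pow2_ge_0.
    assert (H1 : Rabs (1 + h * u n) <= 1 + B).
    { eapply Rle_trans; [apply Rabs_triang|]. rewrite Rabs_R1, Rabs_mult, (Rabs_pos_eq h) by lra.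
      assert (h * Rabs (u n) <= 1 * B) by (apply Rmult_le_compat; try lra; apply Rabs_pos). lra. }
    assert (H2 : Rabs (P - 1 - h * S) * Rabs (1 + h * u n) <= K * h ^ 2 * (1 + B))
      by (apply Rmult_le_compat; auto; apply Rabs_pos).
    assert (H3 : Rabs S * Rabs (u n) <= INR n * B * B)
      by (apply Rmult_le_compat; auto; apply Rabs_pos).
    assert (H4 : h ^ 2 * (Rabs S * Rabs (u n)) <= h ^ 2 * (INR n * B * B))
      by (apply Rmult_le_compat_l; auto; apply pow2_ge_0).
    replace ((K * (1 + B) + INR n * B * B) * h ^ 2)
      with (K * h ^ 2 * (1 + B) + h ^ 2 * (INR n * B * B)) by ring. lra.
Qed.

(* A box is given by its lower corner and its side lengths. *)
Definition box := ((nat -> R) * (nat -> R))%type.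

Definition in_box (N : nat) (b : box) (x : nat -> R) : Prop :=
  forall i, (i < N)%nat -> fst b i <= x i <= fst b i + snd b i.

Definition vol (N : nat) (b : box) : R := rprod N (snd b).

Definition tvol (N : nat) (L : list box) : R := fold_right (fun b s => vol N b + s) 0 L.

Definition pos_box (N : nat) (b : box) : Prop := forall i, (i < N)%nat -> 0 < snd b i.

Definition cov (N : nat) (L : list box) (x : nat -> R) : Prop :=
  exists b, In b L /\ in_box N b x.

Lemma vol_pos N b : pos_box N b -> 0 < vol N b.
Proof. intros H; apply rprod_pos; auto. Qed.

Lemma tvol_app N L1 L2 : tvol N (L1 ++ L2) = tvol N L1 + tvol N L2.
Proof. induction L1; simpl; [|rewrite IHL1]; ring. Qed.

Lemma tvol_nonneg N L : (forall b, In b L -> pos_box N b) -> 0 <= tvol N L.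
Proof.
  induction L; simpl; intros H; [lra|].
  assert (0 < vol N a) by (apply vol_pos, H; auto).
  assert (0 <= tvol N L) by (apply IHL; intros; apply H; auto). lra.
Qed.

Lemma cov_app N L1 L2 x : cov N (L1 ++ L2) x <-> cov N L1 x \/ cov N L2 x.
Proof.
  unfold cov; split.
  - intros [b [Hb Hx]]. apply in_app_or in Hb. destruct Hb; [left|right]; eauto.
  - intros [[b [Hb Hx]]|[b [Hb Hx]]]; exists b; split; auto; apply in_or_app; auto.
Qed.

(** Concatenates covers found box by box. The points [p s] and [q s] are tied by a parameter [s],
    later a whole trajectory, so that no map sending one point to the other has to exist. *)
Lemma cover_bind N (T : Type) (X : T -> Prop) (p q : T -> nat -> R) (Q : box -> Prop) (c : R)
  (L : list box) :
  (forall b, In b L -> exists L', (forall b', In b' L' -> Q b') /\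
     tvol N L' <= c * vol N b /\
     forall s, X s -> in_box N b (p s) -> cov N L' (q s)) ->
  exists L', (forall b', In b' L' -> Q b') /\ tvol N L' <= c * tvol N L /\
     forall s, X s -> cov N L (p s) -> cov N L' (q s).
Proof.
  induction L as [|b L IH]; intros H.
  - exists []; split; [intros _ []|]. split; [simpl; lra|].
    intros s _ [b [[] _]].
  - destruct (H b (or_introl eq_refl)) as [L1 [P1 [V1 C1]]].
    destruct IH as [L2 [P2 [V2 C2]]]; [intros; apply H; right; auto|].
    exists (L1 ++ L2). split; [|split].
    + intros b' Hb; apply in_app_or in Hb; destruct Hb; auto.
    + rewrite tvol_app; simpl; lra.
    + intros s Xs [b' [[<-|Hb] Hx]]; apply cov_app; [left|right]; auto.
      apply C2; auto. exists b'; auto.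
Qed.

Lemma split_interval (a l x : R) (n : nat) : (0 < n)%nat -> 0 <= l -> a <= x <= a + l ->
  exists k, (k < n)%nat /\ a + INR k * (l / INR n) <= x <= a + INR k * (l / INR n) + l / INR n.
Proof.
  intros Hn Hl. assert (Hn' : 0 < INR n) by (apply lt_0_INR; auto).
  set (d := l / INR n).
  assert (Hd : a + l = a + INR n * d) by (unfold d; field; lra). rewrite Hd. clearbody d.
  clear Hd Hn' Hl l. revert Hn. induction n as [|n IH]; [lia|]. intros _ Hx.
  destruct (Rle_dec (a + INR n * d) x) as [H|H].
  - exists n. rewrite S_INR in Hx. split; [lia|]. lra.
  - destruct n; [simpl in H; lra|].
    destruct IH as [k [Hk Hx']]; [lia|lra|]. exists k; split; [lia|auto].
Qed.

Definition slices (b : box) (j : nat) (n : nat) : list box :=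
  map (fun k => (upd (fst b) j (fst b j + INR k * (snd b j / INR n)),
                 upd (snd b) j (/ INR n * snd b j))) (seq 0 n).

Lemma tvol_map_const N (A : Type) (f : A -> box) v l :
  (forall a, In a l -> vol N (f a) = v) -> tvol N (map f l) = INR (length l) * v.
Proof.
  induction l as [|a l IH]; intros H; [simpl; ring|].
  change (vol N (f a) + tvol N (map f l) = INR (S (length l)) * v).
  rewrite S_INR, IH, H; [ring|left; auto|intros; apply H; right; auto].
Qed.

Lemma slices_spec N b j n : (j < N)%nat -> (0 < n)%nat -> pos_box N b ->
  tvol N (slices b j n) = vol N b /\
  forall x, in_box N b x -> cov N (slices b j n) x.
Proof.
  intros Hj Hn Hb. assert (Hn' : 0 < INR n) by (apply lt_0_INR; auto). split.
  - unfold slices. rewrite (tvol_map_const N _ _ (/ INR n * vol N b)).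
    + rewrite length_seq. field; lra.
    + intros k _. unfold vol; simpl. apply rprod_upd_scal; auto.
  - intros x Hx.
    destruct (split_interval (fst b j) (snd b j) (x j) n) as [k [Hk Hxk]]; auto.
    { left; auto. }
    eexists; split.
    { unfold slices; apply in_map_iff; exists k; split; [reflexivity|]. apply in_seq; lia. }
    intros i Hi; simpl. destruct (Nat.eq_dec i j) as [->|Hij].
    + rewrite !upd_same. replace (/ INR n * snd b j) with (snd b j / INR n) by (unfold Rdiv; ring).
      auto.
    + rewrite !upd_other by auto. auto.
Qed.

(** Slices along the directions in [P] one after the other; slicing preserves the total volume. It
    serves to make boxes small in all directions, or thin in all directions but one. *)
Lemma box_refine N (P : nat -> Prop) (d : R) (b : box) : 0 < d -> pos_box N b ->
  exists L, tvol N L <= vol N b /\ (forall x, in_box N b x -> cov N L x) /\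
    forall b', In b' L -> pos_box N b' /\
      forall i, (i < N)%nat -> (P i -> snd b' i <= d) /\ (~ P i -> snd b' i = snd b i).
Proof.
  intros Hd Hb.
  cut (forall M, (M <= N)%nat -> exists L, tvol N L <= vol N b /\
    (forall x, in_box N b x -> cov N L x) /\
    forall b', In b' L -> pos_box N b' /\
      forall i, (i < N)%nat -> ((i < M)%nat -> P i -> snd b' i <= d) /\
        (~ ((i < M)%nat /\ P i) -> snd b' i = snd b i)).
  { intros H. destruct (H N (Nat.le_refl _)) as [L [H1 [H2 H3]]].
    exists L; split; [auto|split; [auto|]]. intros b' Hb'. destruct (H3 b' Hb') as [H4 H5].
    split; auto. intros i Hi; destruct (H5 i Hi) as [H6 H7]. split; auto.
    intros HP; apply H7; tauto. }
  induction M as [|M IH]; intros HM.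
  - exists [b]; split; [simpl; lra|]. split.
    + intros x Hx; exists b; simpl; auto.
    + intros b' [<-|[]]. split; auto. intros i Hi; split; [lia|auto].
  - destruct IH as [L [V [C G]]]; [lia|].
    destruct (classic (P M)) as [HP|HP].
    2:{ exists L; split; [auto|split; [auto|]]. intros b' Hb'. destruct (G b' Hb') as [G1 G2].
        split; auto. intros i Hi; destruct (G2 i Hi) as [G3 G4]. split.
        - intros H1 H2. destruct (Nat.eq_dec i M) as [->|]; [contradiction|]. apply G3; auto; lia.
        - intros H. apply G4. intros [H1 H2]; apply H; split; auto; lia. }
    destruct (cover_bind N _ (fun _ => True) (fun x => x) (fun x => x)
      (fun b' => pos_box N b' /\
        forall i, (i < N)%nat -> ((i < S M)%nat -> P i -> snd b' i <= d) /\
        (~ ((i < S M)%nat /\ P i) -> snd b' i = snd b i)) 1 L) as [L' [G' [V' C']]].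
    + intros b1 Hb1. destruct (G b1 Hb1) as [G1 G2].
      destruct (INR_unbounded (snd b1 M / d)) as [n Hn].
      assert (Hp : 0 < snd b1 M) by (apply G1; lia).
      assert (Hq : 0 < snd b1 M / d) by (apply Rdiv_lt_0_compat; auto).
      assert (Hn0 : (0 < n)%nat).
      { destruct n; [simpl in Hn; lra|lia]. }
      assert (Hn' : 0 < INR n) by (apply lt_0_INR; auto).
      assert (Hle : / INR n * snd b1 M <= d).
      { apply (Rmult_le_reg_l (INR n)); auto. rewrite <- Rmult_assoc, Rinv_r by lra.
        apply (Rmult_lt_compat_r d) in Hn; auto. unfold Rdiv in Hn.
        rewrite Rmult_assoc, Rinv_l in Hn by lra. lra. }
      destruct (slices_spec N b1 M n) as [VS CS]; auto.
      exists (slices b1 M n). split; [|split; [lra|auto]].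
      intros b' Hb'. unfold slices in Hb'. apply in_map_iff in Hb'.
      destruct Hb' as [k [<- _]]. split.
      * intros i Hi; simpl. destruct (Nat.eq_dec i M) as [->|Hi'].
        -- rewrite upd_same. apply Rmult_lt_0_compat; auto. apply Rinv_0_lt_compat; auto.
        -- rewrite upd_other by auto. auto.
      * intros i Hi; simpl. destruct (Nat.eq_dec i M) as [->|Hi'].
        -- rewrite upd_same. split; auto. intros H; exfalso; apply H; auto.
        -- rewrite upd_other by auto. destruct (G2 i Hi) as [G3 G4]. split.
           ++ intros; apply G3; auto; lia.
           ++ intros H; apply G4. intros [? ?]; apply H; split; auto; lia.
    + exists L'; split; [lra|split; [|auto]]. intros x Hx. apply C'; auto.
Qed.

(** The left end is the supremum minus [d]. The set is arbitrary, since the values reached by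
    trajectories through a box are not known to form an interval. *)
Lemma interval_of_diam (S : R -> Prop) (d : R) :
  (forall x y, S x -> S y -> Rabs (x - y) <= d) -> exists a, forall x, S x -> a <= x <= a + d.
Proof.
  intros H. destruct (classic (exists x, S x)) as [[x0 H0]|Hn].
  2:{ exists 0; intros x Hx; exfalso; eauto. }
  destruct (completeness S) as [m [Hm1 Hm2]].
  - exists (x0 + d). intros x Hx. specialize (H x x0 Hx H0). apply Rabs_le_between in H. lra.
  - exists x0; auto.
  - exists (m - d). intros x Hx. split; [|specialize (Hm1 x Hx); lra].
    assert (m <= x + d); [|lra]. apply Hm2. intros y Hy. specialize (H y x Hy Hx).
    apply Rabs_le_between in H. lra.
Qed.

(* After cutting the box thinly in the directions other than [i], the off-diagonal constant [C]
   contributes only [eps]. *)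
Lemma coordinate_step N (T : Type) (X : T -> Prop) (p q : T -> nat -> R) (i : nat)
  (lam C eps : R) (b : box) :
  (i < N)%nat -> pos_box N b -> 0 < lam -> 0 <= C -> 0 < eps ->
  (forall s, X s -> forall j, (j < N)%nat -> j <> i -> q s j = p s j) ->
  (forall s t d, X s -> X t -> 0 <= d ->
     (forall j, (j < N)%nat -> j <> i -> Rabs (p s j - p t j) <= d) ->
     Rabs (q s i - q t i) <= lam * Rabs (p s i - p t i) + C * d) ->
  exists L, (forall b', In b' L -> pos_box N b') /\
    tvol N L <= (lam + eps) * vol N b /\
    forall s, X s -> in_box N b (p s) -> cov N L (q s).
Proof.
  intros Hi Hb Hlam HC Heps Hq Hest.
  assert (Hli : 0 < snd b i) by auto.
  (* The thickness is chosen so that [C * d] costs at most [eps] times the side in direction [i];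
     the [+ 1] covers the case [C = 0]. *)
  set (d := eps * snd b i / (C + 1)).
  assert (Hd : 0 < d).
  { apply Rdiv_lt_0_compat; [apply Rmult_lt_0_compat; auto|lra]. }
  assert (HCd : C * d <= eps * snd b i).
  { unfold d. replace (eps * snd b i) with ((C + 1) * (eps * snd b i / (C + 1))) at 2
      by (field; lra). apply Rmult_le_compat_r; [left; exact Hd|lra]. }
  destruct (box_refine N (fun j => j <> i) d b Hd Hb) as [L [V [Cv G]]].
  destruct (cover_bind N T X p q (pos_box N) (lam + eps) L) as [L' [G' [V' C']]].
  - intros b1 Hb1. destruct (G b1 Hb1) as [G1 G2].
    assert (Hl1 : snd b1 i = snd b i) by (apply G2; auto).
    (* Over one thin box the new [i]-th coordinates have diameter at most [(lam + eps)] times the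
       old side, and the other coordinates do not move: one box suffices. *)
    destruct (interval_of_diam (fun v => exists s, X s /\ in_box N b1 (p s) /\ v = q s i)
      ((lam + eps) * snd b1 i)) as [al Hal].
    + intros v w [s [Xs [Bs ->]]] [t [Xt [Bt ->]]].
      eapply Rle_trans; [apply (Hest s t d Xs Xt (Rlt_le _ _ Hd))|].
      * intros j Hj Hji. specialize (Bs j Hj); specialize (Bt j Hj).
        destruct (G2 j Hj) as [G3 _]. specialize (G3 Hji). apply Rabs_le. lra.
      * rewrite Hl1. assert (lam * Rabs (p s i - p t i) <= lam * snd b i).
        { apply Rmult_le_compat_l; [lra|]. specialize (Bs i Hi); specialize (Bt i Hi).
          apply Rabs_le. lra. }
        lra.
    + exists [(upd (fst b1) i al, upd (snd b1) i ((lam + eps) * snd b1 i))].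
      split; [|split].
      * intros b' [<-|[]] j Hj; simpl. destruct (Nat.eq_dec j i) as [->|Hji].
        -- rewrite upd_same. apply Rmult_lt_0_compat; [lra|auto].
        -- rewrite upd_other by auto. auto.
      * simpl. unfold vol at 1; simpl. rewrite rprod_upd_scal by auto. unfold vol; lra.
      * intros s Xs Bs. eexists; split; [left; reflexivity|]. intros j Hj; simpl.
        destruct (Nat.eq_dec j i) as [->|Hji].
        -- rewrite !upd_same. apply Hal. eauto.
        -- rewrite !upd_other by auto. rewrite Hq by auto. auto.
  - exists L'; split; [auto|split].
    + eapply Rle_trans; [exact V'|]. apply Rmult_le_compat_l; lra.
    + intros s Xs Bs. apply C'; auto.
Qed.

Definition mixed (x y : nat -> R) (k : nat) : nat -> R :=
  fun j => if Nat.ltb j k then x j else y j.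

(* Replacing the coordinates one at a time makes the volume factor a product of diagonal
   coefficients, so no determinant is needed. *)
Lemma sweep N (T : Type) (X : T -> Prop) (x y : T -> nat -> R) (lam : nat -> R)
  (C eps : R) (b : box) :
  pos_box N b -> (forall i, (i < N)%nat -> 0 < lam i) -> 0 <= C -> 0 < eps ->
  (forall i s t d, (i < N)%nat -> X s -> X t -> 0 <= d ->
     (forall j, (j < N)%nat -> j <> i ->
        Rabs (mixed (x s) (y s) i j - mixed (x t) (y t) i j) <= d) ->
     Rabs (x s i - x t i) <= lam i * Rabs (y s i - y t i) + C * d) ->
  exists L, (forall b', In b' L -> pos_box N b') /\
    tvol N L <= rprod N (fun i => lam i + eps) * vol N b /\
    forall s, X s -> in_box N b (y s) -> cov N L (x s).
Proof.
  intros Hb Hlam HC Heps Hest.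
  cut (forall k, (k <= N)%nat -> exists L, (forall b', In b' L -> pos_box N b') /\
    tvol N L <= rprod k (fun i => lam i + eps) * vol N b /\
    forall s, X s -> in_box N b (y s) -> cov N L (mixed (x s) (y s) k)).
  { intros H. destruct (H N (Nat.le_refl _)) as [L [P [V Cv]]].
    exists L; split; [auto|split; [auto|]]. intros s Xs Bs.
    destruct (Cv s Xs Bs) as [b' [Hb' Hin]]. exists b'; split; auto.
    intros i Hi. specialize (Hin i Hi). unfold mixed in Hin.
    destruct (Nat.ltb_spec i N); [auto|lia]. }
  induction k as [|k IH]; intros Hk.
  - exists [b]. split; [intros b' [<-|[]]; auto|]. split; [simpl; lra|].
    intros s Xs Bs. exists b; split; [left; auto|]. exact Bs.
  - destruct IH as [L [P [V Cv]]]; [lia|].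
    destruct (cover_bind N T X (fun s => mixed (x s) (y s) k) (fun s => mixed (x s) (y s) (S k))
      (pos_box N) (lam k + eps) L) as [L' [P' [V' C']]].
    + intros b1 Hb1. apply (coordinate_step N T X _ _ k (lam k) C eps b1); auto.
      * intros s Xs j Hj Hjk. unfold mixed.
        destruct (Nat.ltb_spec j (S k)), (Nat.ltb_spec j k); auto; lia.
      * intros s t d Xs Xt Hd0 Hd. unfold mixed at 1 2 3 4.
        destruct (Nat.ltb_spec k (S k)), (Nat.ltb_spec k k); try lia. auto.
    + exists L'; split; [auto|split; [|auto]]. eapply Rle_trans; [exact V'|]. simpl.
      rewrite (Rmult_comm (rprod k _)), Rmult_assoc. apply Rmult_le_compat_l; auto.
      specialize (Hlam k Hk). lra.
Qed.

(** [L1] collects the boxes satisfying [hit], on which the volume factor improves by [g]. A lower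
    bound for [tvol N L'] then becomes an upper bound for [tvol N L1]. *)
Lemma cover_bind_gain N (T : Type) (X : T -> Prop) (p q : T -> nat -> R) (hit : box -> Prop)
  (c g : R) (L : list box) :
  (forall b, In b L -> exists L', (forall b', In b' L' -> pos_box N b') /\
     tvol N L' <= c * vol N b /\ (hit b -> tvol N L' <= (c - g) * vol N b) /\
     forall s, X s -> in_box N b (p s) -> cov N L' (q s)) ->
  exists L1 L', (forall b, In b L1 -> In b L) /\ (forall b, In b L -> hit b -> In b L1) /\
     (forall b', In b' L' -> pos_box N b') /\
     tvol N L' <= c * tvol N L - g * tvol N L1 /\
     forall s, X s -> cov N L (p s) -> cov N L' (q s).
Proof.
  induction L as [|b L IH]; intros H.
  - exists [], []; repeat split; try (intros _ []); try (simpl; lra); auto.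
    intros s _ [b [[] _]].
  - destruct (H b (or_introl eq_refl)) as [L2 [P2 [V2 [G2 C2]]]].
    destruct IH as [L1 [L' [S1 [S2 [P' [V' C']]]]]]; [intros; apply H; right; auto|].
    assert (Hpos : forall b', In b' (L2 ++ L') -> pos_box N b').
    { intros b' Hb; apply in_app_or in Hb; destruct Hb; auto. }
    assert (Hcov : forall s, X s -> cov N (b :: L) (p s) -> cov N (L2 ++ L') (q s)).
    { intros s Xs [b' [[<-|Hb] Hx]]; apply cov_app; [left|right]; auto.
      apply C'; auto. exists b'; auto. }
    destruct (classic (hit b)) as [Hh|Hh].
    + exists (b :: L1), (L2 ++ L'). split; [|split; [|split; [auto|split; [|auto]]]].
      * intros b' [<-|Hb]; [left; auto|right; auto].
      * intros b' [<-|Hb] Hhit; [left; auto|right; auto].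
      * rewrite tvol_app. specialize (G2 Hh). simpl. lra.
    + exists L1, (L2 ++ L'). split; [|split; [|split; [auto|split; [|auto]]]].
      * intros b' Hb; right; auto.
      * intros b' [<-|Hb] Hhit; [contradiction|auto].
      * rewrite tvol_app. simpl. lra.
Qed.

Lemma in_box_ext N b x y : (forall i, (i < N)%nat -> x i = y i) -> in_box N b x -> in_box N b y.
Proof. intros H Hx i Hi. rewrite <- H by auto. auto. Qed.

Lemma cov_ext N L x y : (forall i, (i < N)%nat -> x i = y i) -> cov N L x -> cov N L y.
Proof. intros H [b [Hb Hx]]. exists b; split; auto. apply (in_box_ext N b x y); auto. Qed.

(** * Countable unions of finitely covered sets *)

Lemma tvol_nth N (d : box) L K : (forall b, In b L -> pos_box N b) -> (K <= length L)%nat ->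
  rsum K (fun k => vol N (nth k L d)) <= tvol N L.
Proof.
  revert K; induction L as [|b L IH]; intros K HP HK.
  - simpl in HK. replace K with O by lia. simpl; lra.
  - assert (Hb : 0 < vol N b) by (apply vol_pos, HP; left; auto).
    assert (HP' : forall b, In b L -> pos_box N b) by (intros; apply HP; right; auto).
    assert (Hshift : forall K, rsum (S K) (fun k => vol N (nth k (b :: L) d)) =
      vol N b + rsum K (fun k => vol N (nth k L d))).
    { induction K0; [simpl; ring|].
      change (rsum (S (S K0)) (fun k => vol N (nth k (b :: L) d)))
        with (rsum (S K0) (fun k => vol N (nth k (b :: L) d)) + vol N (nth K0 L d)).
      rewrite IHK0; simpl; ring. }
    destruct K as [|K].
    + simpl. generalize (tvol_nonneg N L HP'); lra.
    + rewrite Hshift. change (tvol N (b :: L)) with (vol N b + tvol N L).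
      apply Rplus_le_compat_l, IH; auto. simpl in HK; lia.
Qed.

(** Concatenation of [L 0], ..., [L k]. When no list is empty it has more than [k] entries, so the
    [k]-th box of the infinite concatenation can be read off in [prefix L k], without pairing
    indices. *)
Fixpoint prefix (L : nat -> list box) (k : nat) : list box :=
  match k with O => L O | S k => prefix L k ++ L (S k) end.

Lemma prefix_length L k : (forall n, L n <> []) -> (k < length (prefix L k))%nat.
Proof.
  intros H. induction k; simpl.
  - specialize (H O). destruct (L O); [congruence|simpl; lia].
  - rewrite length_app. specialize (H (S k)). destruct (L (S k)); [congruence|simpl; lia].
Qed.

Lemma prefix_nth L k m n d : (m <= n)%nat -> (k < length (prefix L m))%nat ->
  (k < length (prefix L n))%nat /\ nth k (prefix L n) d = nth k (prefix L m) d.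
Proof.
  intros Hmn Hk. induction n as [|n IH].
  - replace m with O in * by lia; auto.
  - destruct (Nat.eq_dec m (S n)) as [->|]; auto. simpl.
    destruct IH as [H1 H2]; [lia|]. rewrite length_app, app_nth1 by auto. split; [lia|auto].
Qed.

Lemma lebesgue_null_of_finite_covers N (A : nat -> (nat -> R) -> Prop) : (1 <= N)%nat ->
  (forall n eps, 0 < eps -> exists L, (forall b, In b L -> pos_box N b) /\
     tvol N L <= eps /\ forall x, A n x -> cov N L x) ->
  lebesgue_null N (fun x => exists n, A n x).
Proof.
  intros HN H eps Heps.
  assert (Hp : forall n, 0 < eps / 2 ^ (S n)).
  { intros n. apply Rdiv_lt_0_compat; auto. apply pow_lt; lra. }
  (* A box of prescribed volume, of side [v] in direction 0 and 1 elsewhere; adding one to each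
     cover keeps the lists nonempty, as [prefix] requires. *)
  assert (Htiny : forall v, 0 < v -> exists b, pos_box N b /\ vol N b = v).
  { intros v Hv. exists ((fun _ => 0), upd (fun _ => 1) O (v * 1)). split.
    - intros i Hi; simpl. destruct (Nat.eq_dec i O) as [->|]; [rewrite upd_same; lra|].
      rewrite upd_other by auto. lra.
    - unfold vol; simpl. rewrite (rprod_upd_scal N (fun _ => 1)) by lia.
      replace (rprod N (fun _ => 1)) with 1; [ring|].
      clear. induction N; simpl; [|rewrite <- IHN]; ring. }
  assert (HL : forall n, exists L, L <> [] /\ (forall b, In b L -> pos_box N b) /\
     tvol N L <= eps / 2 ^ (S n) /\ forall x, A n x -> cov N L x).
  { intros n. destruct (H n (eps / 2 ^ (S n) / 2)) as [L [P [V C]]]; [specialize (Hp n); lra|].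
    destruct (Htiny (eps / 2 ^ (S n) / 2)) as [b [Pb Vb]]; [specialize (Hp n); lra|].
    exists (b :: L). split; [discriminate|]. split; [intros b' [<-|]; auto|].
    split; [simpl in *; lra|]. intros x Ax. destruct (C x Ax) as [b' [Hb' Hx]].
    exists b'; split; auto. right; auto. }
  apply functional_choice in HL. destruct HL as [L HL].
  assert (Hne : forall n, L n <> []) by (intros; apply HL).
  assert (Hpos : forall k b, In b (prefix L k) -> pos_box N b).
  { induction k; simpl; intros b Hb; [eapply HL; eauto|].
    apply in_app_or in Hb; destruct Hb; auto. eapply HL; eauto. }
  (* The geometric budget: the sum of [eps / 2 ^ (n+1)] over [n <= k] equals
     [eps - eps / 2 ^ (k+1)]. *)
  assert (Hvol : forall k, tvol N (prefix L k) <= eps - eps / 2 ^ (S k)).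
  { induction k.
    - destruct (HL O) as [_ [_ [V _]]]. simpl in *. lra.
    - simpl prefix. rewrite tvol_app. destruct (HL (S k)) as [_ [_ [V _]]].
      replace (eps / 2 ^ S k) with (2 * (eps / 2 ^ S (S k))) in IHk; [lra|].
      simpl. field. apply pow_nonzero; lra. }
  set (d := ((fun _ => 0), (fun _ => 0)) : box).
  set (bx := fun k => nth k (prefix L k) d).
  assert (Hbx : forall k, pos_box N (bx k)).
  { intros k. apply (Hpos k). apply nth_In, prefix_length; auto. }
  exists (fun k i => fst (bx k) i), (fun k i => fst (bx k) i + snd (bx k) i).
  split; [|split].
  - intros k i Hi. specialize (Hbx k i Hi). lra.
  - intros x [n Ax]. destruct (HL n) as [_ [_ [_ C]]]. destruct (C x Ax) as [b [Hb Hx]].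
    assert (Hin : In b (prefix L n)) by (destruct n; simpl; [auto|apply in_or_app; auto]).
    destruct (In_nth _ _ d Hin) as [k [Hk E]].
    exists k. assert (bx k = b) as ->; [|exact Hx].
    assert (Hkk : (k < length (prefix L k))%nat) by (apply prefix_length; auto).
    unfold bx. rewrite <- E. destruct (Nat.le_ge_cases k n).
    + symmetry; apply prefix_nth; auto.
    + apply prefix_nth; auto.
  - intros K. destruct K; [simpl; lra|].
    eapply Rle_trans; [|eapply Rle_trans; [apply (tvol_nth N d (prefix L K) (S K))|]].
    + right; apply rsum_ext. intros k Hk. unfold bx.
      destruct (prefix_nth L k k K d) as [_ ->]; [lia|apply prefix_length; auto|].
      apply rprod_ext; intros; ring.
    + apply Hpos.
    + apply prefix_length; auto.
    + generalize (Hvol K) (Hp K); lra.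
Qed.

(** * The Winfree field and pairs of trajectories *)

Lemma mean_value (f df : R -> R) (a b : R) :
  (forall x, Rmin a b < x < Rmax a b -> is_derive f x (df x)) ->
  (forall x, continuity_pt f x) ->
  exists c, Rmin a b <= c <= Rmax a b /\ f b - f a = df c * (b - a).
Proof. intros H1 H2. apply MVT_gen; auto. Qed.

(** Here the intermediate point is strictly inside the interval, as needed when the sign of the
    derivative or the continuity of [f] is known only on part of the line. *)
Lemma mean_value_lt (f df : R -> R) (a b : R) : a < b ->
  (forall x, a < x < b -> is_derive f x (df x)) ->
  (forall x, a <= x <= b -> continuity_pt f x) ->
  exists c, a < c < b /\ f b - f a = df c * (b - a).
Proof.
  intros Hab H1 H2.
  assert (pr : forall c, a < c < b -> derivable_pt f c).
  { intros c Hc. exists (df c). apply is_derive_Reals; auto. }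
  destruct (MVT f id a b pr (fun c _ => derivable_pt_id c) Hab H2) as [c [Hc E]].
  { intros; apply derivable_continuous_pt, derivable_pt_id. }
  exists c; split; auto. rewrite derive_pt_id in E. unfold id in E.
  rewrite (derive_pt_eq_0 f c (df c) (pr c Hc)) in E.
  - lra.
  - apply is_derive_Reals; auto.
Qed.

Lemma is_derive_sin_R x : is_derive sin x (cos x).
Proof. apply is_derive_Reals, derivable_pt_lim_sin. Qed.

Lemma is_derive_cos_R x : is_derive cos x (- sin x).
Proof. apply is_derive_Reals, derivable_pt_lim_cos. Qed.

Lemma sin_diff a b : exists c, Rmin a b <= c <= Rmax a b /\ sin b - sin a = cos c * (b - a).
Proof. apply mean_value; [intros; apply is_derive_sin_R|apply continuity_sin]. Qed.

Lemma cos_diff a b : exists c, Rmin a b <= c <= Rmax a b /\ cos b - cos a = - sin c * (b - a).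
Proof.
  apply (mean_value cos (fun c => - sin c)); [intros; apply is_derive_cos_R|apply continuity_cos].
Qed.

Lemma Rabs_sin_le x : Rabs (sin x) <= 1.
Proof. apply Rabs_le. apply SIN_bound. Qed.

Lemma Rabs_cos_le x : Rabs (cos x) <= 1.
Proof. apply Rabs_le. apply COS_bound. Qed.

Lemma Rabs_mult_le a b A B : Rabs a <= A -> Rabs b <= B -> Rabs (a * b) <= A * B.
Proof. intros; rewrite Rabs_mult; apply Rmult_le_compat; auto; apply Rabs_pos. Qed.

Lemma sin_lip a b : Rabs (sin a - sin b) <= Rabs (a - b).
Proof.
  destruct (sin_diff b a) as [c [_ ->]]. rewrite <- (Rmult_1_l (Rabs (a - b))).
  apply Rabs_mult_le; [apply Rabs_cos_le|lra].
Qed.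

Lemma cos_lip a b : Rabs (cos a - cos b) <= Rabs (a - b).
Proof.
  destruct (cos_diff b a) as [c [_ ->]]. rewrite <- (Rmult_1_l (Rabs (a - b))).
  apply Rabs_mult_le; [rewrite Rabs_Ropp; apply Rabs_sin_le|lra].
Qed.

Lemma between_dist a b c z r : Rmin a b <= c <= Rmax a b ->
  Rabs (a - z) <= r -> Rabs (b - z) <= r -> Rabs (c - z) <= r.
Proof.
  intros Hc Ha Hb. apply Rabs_le_between in Ha. apply Rabs_le_between in Hb.
  apply Rabs_le. unfold Rmin, Rmax in Hc. destruct (Rle_dec a b); lra.
Qed.

(** The slope is frozen at a base point [z] common to all pairs, so a single coefficient serves for
    a whole small box. *)
Lemma sin_linear a b z r : Rabs (a - z) <= r -> Rabs (b - z) <= r ->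
  Rabs (sin a - sin b - cos z * (a - b)) <= r * Rabs (a - b).
Proof.
  intros Ha Hb. destruct (sin_diff b a) as [c [Hc ->]].
  replace (cos c * (a - b) - cos z * (a - b)) with ((cos c - cos z) * (a - b)) by ring.
  apply Rabs_mult_le; [|lra]. eapply Rle_trans; [apply cos_lip|].
  eapply between_dist; eauto.
Qed.

Lemma cos_linear a b z r : Rabs (a - z) <= r -> Rabs (b - z) <= r ->
  Rabs (cos a - cos b + sin z * (a - b)) <= r * Rabs (a - b).
Proof.
  intros Ha Hb. destruct (cos_diff b a) as [c [Hc ->]].
  replace (- sin c * (a - b) + sin z * (a - b)) with (- (sin c - sin z) * (a - b)) by ring.
  apply Rabs_mult_le; [|lra]. rewrite Rabs_Ropp. eapply Rle_trans; [apply sin_lip|].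
  eapply between_dist; eauto.
Qed.

Lemma rhs_order_param N om ka th i :
  winfree_rhs N om ka th i = om i - ka * order_param N th * sin (th i).
Proof. unfold winfree_rhs, order_param, Rdiv; ring. Qed.

Lemma mean_abs_le N f B : (1 <= N)%nat ->
  (forall j, (j < N)%nat -> Rabs (f j) <= B) -> Rabs (/ INR N * rsum N f) <= B.
Proof.
  intros HN H. assert (HN' : 0 < INR N) by (apply lt_0_INR; lia).
  assert (Hi : 0 < / INR N) by (apply Rinv_0_lt_compat; auto).
  rewrite Rabs_mult, (Rabs_pos_eq (/ INR N)) by lra.
  apply (Rmult_le_reg_l (INR N)); auto. rewrite <- Rmult_assoc, Rinv_r, Rmult_1_l by lra.
  eapply Rle_trans; [apply rsum_abs|]. rewrite <- rsum_const. apply rsum_le; auto.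
Qed.

Lemma order_param_bounds N th : (1 <= N)%nat -> 0 <= order_param N th <= 2.
Proof.
  intros HN. assert (HN' : 0 < INR N) by (apply lt_0_INR; lia).
  unfold order_param. split.
  - apply Rmult_le_pos; [left; apply Rinv_0_lt_compat; auto|].
    apply rsum_nonneg; intros. generalize (COS_bound (th i)); lra.
  - eapply Rle_trans; [apply Rle_abs|]. apply mean_abs_le; auto.
    intros j _. apply Rabs_le. generalize (COS_bound (th j)); lra.
Qed.

Lemma order_param_diff N u v :
  order_param N u - order_param N v = / INR N * rsum N (fun j => cos (u j) - cos (v j)).
Proof.
  unfold order_param. rewrite <- Rmult_minus_distr_l, <- rsum_minus.
  f_equal. apply rsum_ext; intros; ring.
Qed.

Lemma order_param_lip N u v d : (1 <= N)%nat ->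
  (forall j, (j < N)%nat -> Rabs (u j - v j) <= d) ->
  Rabs (order_param N u - order_param N v) <= d.
Proof.
  intros HN H. rewrite order_param_diff. apply mean_abs_le; auto.
  intros j Hj. eapply Rle_trans; [apply cos_lip|auto].
Qed.

(** The diagonal entry of the Jacobian of the field, that is the derivative of the [i]-th component
    with respect to the [i]-th angle. *)
Definition rhs_diag (N : nat) (ka : R) (z : nat -> R) (i : nat) : R :=
  ka * (/ INR N * (sin (z i))^2 - order_param N z * cos (z i)).

Lemma rsum_single N i c : (i < N)%nat ->
  rsum N (fun j => if Nat.eq_dec j i then c else 0) = c.
Proof.
  induction N; intros Hi; [lia|]. simpl. destruct (Nat.eq_dec N i) as [->|Hn].
  - rewrite (rsum_ext _ _ (fun _ => 0)), rsum_const; [ring|].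
    intros j Hj; destruct Nat.eq_dec; auto; lia.
  - rewrite IHN by lia. ring.
Qed.

(** Only the diagonal coefficient is kept exactly; the differences in the other coordinates enter
    through their bound [e], with no smallness in front of it. *)
Lemma rhs_linear N om ka u v z r e i : (1 <= N)%nat -> 0 < ka -> (i < N)%nat ->
  (forall j, (j < N)%nat -> Rabs (u j - z j) <= r) ->
  (forall j, (j < N)%nat -> Rabs (v j - z j) <= r) ->
  (forall j, (j < N)%nat -> j <> i -> Rabs (u j - v j) <= e) -> 0 <= e ->
  Rabs (winfree_rhs N om ka u i - winfree_rhs N om ka v i - rhs_diag N ka z i * (u i - v i))
   <= ka * (e + 5 * r * Rabs (u i - v i)).
Proof.
  intros HN Hka Hi Hu Hv He He0.
  assert (HN' : 1 <= INR N) by (apply (le_INR 1); auto).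
  assert (Hn : 0 < / INR N <= 1).
  { split; [apply Rinv_0_lt_compat; lra|]. rewrite <- Rinv_1. apply Rinv_le_contravar; lra. }
  set (D := u i - v i). rewrite !rhs_order_param. unfold rhs_diag.
  set (Ru := order_param N u). set (Rv := order_param N v). set (Rz := order_param N z).
  assert (Hr : 0 <= r) by (eapply Rle_trans; [apply Rabs_pos|apply (Hu i Hi)]).
  assert (HD : 0 <= r * Rabs D) by (apply Rmult_le_pos; auto; apply Rabs_pos).
  assert (H1 : Rabs (Ru - Rv + / INR N * (sin (z i) * D)) <= e + r * Rabs D).
  { unfold Ru, Rv. rewrite order_param_diff.
    rewrite <- (rsum_single N i (sin (z i) * D)) by auto.
    rewrite <- Rmult_plus_distr_l, <- rsum_plus. apply mean_abs_le; auto.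
    intros j Hj. destruct (Nat.eq_dec j i) as [->|Hji].
    - assert (H := cos_linear (u i) (v i) (z i) r (Hu i Hi) (Hv i Hi)). fold D in H. lra.
    - rewrite Rplus_0_r. assert (H := cos_lip (u j) (v j)). specialize (He j Hj Hji). lra. }
  assert (H2 : Rabs (sin (u i) - sin (v i) - cos (z i) * D) <= r * Rabs D)
    by (apply sin_linear; auto).
  assert (H3 : Rabs (Rv - Rz) <= r) by (apply order_param_lip; auto).
  assert (H4 : Rabs (sin (z i) - sin (u i)) <= r).
  { eapply Rle_trans; [apply sin_lip|]. rewrite Rabs_minus_sym; auto. }
  assert (H5 : 0 <= Rv <= 2) by (apply order_param_bounds; auto).
  replace (om i - ka * Ru * sin (u i) - (om i - ka * Rv * sin (v i)) -
     ka * (/ INR N * sin (z i) ^ 2 - Rz * cos (z i)) * D)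
   with (- ka * ((Ru - Rv + / INR N * (sin (z i) * D)) * sin (u i)
      + / INR N * (sin (z i) * (D * (sin (z i) - sin (u i))))
      + (Rv * (sin (u i) - sin (v i) - cos (z i) * D) + (Rv - Rz) * (cos (z i) * D)))) by ring.
  rewrite Rabs_mult, Rabs_Ropp, (Rabs_pos_eq ka) by lra.
  apply Rmult_le_compat_l; [lra|].
  (* The four errors contribute [r], [r], [2 r] and [r] times [|D|], which gives the constant 5. *)
  assert (A1 := Rabs_mult_le _ _ _ _ H1 (Rabs_sin_le (u i))).
  assert (A2 : Rabs (/ INR N * (sin (z i) * (D * (sin (z i) - sin (u i))))) <=
     1 * (1 * (Rabs D * r))).
  { repeat apply Rabs_mult_le; auto; [|apply Rabs_sin_le|lra].
    rewrite Rabs_pos_eq; lra. }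
  assert (A3 : Rabs (Rv * (sin (u i) - sin (v i) - cos (z i) * D)) <= 2 * (r * Rabs D)).
  { apply Rabs_mult_le; auto. rewrite Rabs_pos_eq; lra. }
  assert (A4 : Rabs ((Rv - Rz) * (cos (z i) * D)) <= r * (1 * Rabs D)).
  { repeat apply Rabs_mult_le; auto; [apply Rabs_cos_le|lra]. }
  eapply Rle_trans; [apply Rabs_triang|].
  eapply Rle_trans; [apply Rplus_le_compat; [apply Rabs_triang|apply Rabs_triang]|]. lra.
Qed.

Lemma rhs_lip N om ka u v d i : (1 <= N)%nat -> 0 < ka -> (i < N)%nat ->
  (forall j, (j < N)%nat -> Rabs (u j - v j) <= d) ->
  Rabs (winfree_rhs N om ka u i - winfree_rhs N om ka v i) <= 3 * ka * d.
Proof.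
  intros HN Hka Hi H. rewrite !rhs_order_param.
  replace (om i - ka * order_param N u * sin (u i) - (om i - ka * order_param N v * sin (v i)))
   with (- ka * ((order_param N u - order_param N v) * sin (u i) +
      order_param N v * (sin (u i) - sin (v i)))) by ring.
  rewrite Rabs_mult, Rabs_Ropp, (Rabs_pos_eq ka) by lra.
  replace (3 * ka * d) with (ka * (d * 1 + 2 * d)) by ring.
  apply Rmult_le_compat_l; [lra|]. eapply Rle_trans; [apply Rabs_triang|].
  apply Rplus_le_compat; apply Rabs_mult_le.
  - apply order_param_lip; auto.
  - apply Rabs_sin_le.
  - rewrite Rabs_pos_eq; apply order_param_bounds; auto.
  - eapply Rle_trans; [apply sin_lip|auto].
Qed.

Lemma rhs_bound N om ka th i : (1 <= N)%nat -> 0 < ka -> (i < N)%nat ->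
  Rabs (winfree_rhs N om ka th i) <= rsum N (fun j => Rabs (om j)) + 2 * ka.
Proof.
  intros HN Hka Hi. rewrite rhs_order_param.
  assert (H1 : Rabs (om i) <= rsum N (fun j => Rabs (om j))).
  { apply (rsum_term N (fun j => Rabs (om j))); auto. intros; apply Rabs_pos. }
  assert (H2 : Rabs (ka * order_param N th * sin (th i)) <= ka * 2 * 1).
  { apply Rabs_mult_le; [|apply Rabs_sin_le]. apply Rabs_mult_le; rewrite Rabs_pos_eq; try lra;
      apply order_param_bounds; auto. }
  unfold Rminus. eapply Rle_trans; [apply Rabs_triang|]. rewrite Rabs_Ropp. lra.
Qed.

Lemma rhs_diag_bound N ka z i : (1 <= N)%nat -> 0 < ka ->
  Rabs (rhs_diag N ka z i) <= 3 * ka.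
Proof.
  intros HN Hka. unfold rhs_diag. rewrite Rmult_comm.
  apply Rabs_mult_le; [|rewrite Rabs_pos_eq; lra].
  assert (HN' : 1 <= INR N) by (apply (le_INR 1); auto).
  assert (Hn : 0 < / INR N <= 1).
  { split; [apply Rinv_0_lt_compat; lra|]. rewrite <- Rinv_1. apply Rinv_le_contravar; lra. }
  unfold Rminus. eapply Rle_trans; [apply Rabs_triang|]. rewrite Rabs_Ropp.
  replace 3 with (1 * (1 * 1) + 2 * 1) by ring. apply Rplus_le_compat; apply Rabs_mult_le.
  - rewrite Rabs_pos_eq; lra.
  - simpl. rewrite Rmult_1_r. apply Rabs_mult_le; apply Rabs_sin_le.
  - rewrite Rabs_pos_eq; apply order_param_bounds; auto.
  - apply Rabs_cos_le.
Qed.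

(** The cosines sum to [N (R - 1)], so their part of the trace is [ka N R (1 - R)], nonnegative
    because [0 <= R <= 1]. Among the squared sines only that of angle 0 is retained. *)
Lemma rhs_trace N ka z : (1 <= N)%nat -> 0 < ka -> order_param N z <= 1 ->
  rsum N (rhs_diag N ka z) >= ka / INR N * (sin (z O))^2.
Proof.
  intros HN Hka H1. assert (HN' : 0 < INR N) by (apply lt_0_INR; lia).
  assert (H0 := order_param_bounds N z HN).
  unfold rhs_diag. rewrite rsum_scal, rsum_minus, !rsum_scal.
  assert (Hc : rsum N (fun i => cos (z i)) = INR N * (order_param N z - 1)).
  { unfold order_param. rewrite rsum_plus, rsum_const. field; lra. }
  rewrite Hc. unfold Rdiv. rewrite Rmult_assoc. apply Rle_ge, Rmult_le_compat_l; [lra|].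
  assert (Hs : sin (z O) ^ 2 <= rsum N (fun i => sin (z i) ^ 2)).
  { apply (rsum_term N (fun i => sin (z i) ^ 2)); [intros; apply pow2_ge_0|lia]. }
  apply (Rmult_le_compat_l (/ INR N)) in Hs; [|left; apply Rinv_0_lt_compat; auto].
  assert (0 <= order_param N z * (INR N * (1 - order_param N z))).
  { apply Rmult_le_pos; [|apply Rmult_le_pos]; lra. }
  replace (order_param N z * (INR N * (order_param N z - 1)))
    with (- (order_param N z * (INR N * (1 - order_param N z)))) by ring.
  lra.
Qed.

(** * Backward comparison of two trajectories over a short time *)

(** Continuity is asked at every real time, also at [t <= 0], so that mean values and maxima on
    [[0, h]] need no one-sided limits; the equation itself is asked only for [t > 0]. *)
Definition trajectory (N : nat) (om : nat -> R) (ka : R) (th : R -> nat -> R) : Prop :=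
  (forall i, (i < N)%nat -> forall t, continuity_pt (fun s => th s i) t) /\
  (forall t, 0 < t -> forall i, (i < N)%nat ->
     is_derive (fun s => th s i) t (winfree_rhs N om ka (th t) i)).

(** The maximum over coordinates and times is the quantity [D] that [trajectory_pair] absorbs into
    itself instead of using a Gronwall inequality. *)
Lemma sup_dist_attained N (d : R -> nat -> R) h : (1 <= N)%nat -> 0 <= h ->
  (forall i, (i < N)%nat -> forall t, continuity_pt (fun s => d s i) t) ->
  exists j t, (j < N)%nat /\ 0 <= t <= h /\
    forall i s, (i < N)%nat -> 0 <= s <= h -> Rabs (d s i) <= Rabs (d t j).
Proof.
  intros HN Hh Hc.
  assert (H1 : forall i, (i < N)%nat -> exists t, 0 <= t <= h /\
    forall s, 0 <= s <= h -> Rabs (d s i) <= Rabs (d t i)).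
  { intros i Hi. destruct (continuity_ab_maj (fun s => Rabs (d s i)) 0 h Hh) as [t [Ht1 Ht2]].
    - intros c _. apply (continuity_pt_comp (fun s => d s i) Rabs); auto. apply Rcontinuity_abs.
    - exists t; split; auto. }
  assert (H2 : forall M, (S M <= N)%nat -> exists j t, (j < N)%nat /\ 0 <= t <= h /\
    forall i s, (i < S M)%nat -> 0 <= s <= h -> Rabs (d s i) <= Rabs (d t j)).
  { induction M as [|M IH]; intros HM.
    - destruct (H1 O HM) as [t [Ht H]]. exists O, t; split; [auto|split; [auto|]].
      intros i s Hi Hs. replace i with O by lia. auto.
    - destruct IH as [j [t [Hj [Ht H]]]]; [lia|]. destruct (H1 (S M) HM) as [t' [Ht' H']].
      destruct (Rle_dec (Rabs (d t j)) (Rabs (d t' (S M)))) as [Hle|Hle].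
      + exists (S M), t'; split; [auto|split; [auto|]]. intros i s Hi Hs.
        destruct (Nat.eq_dec i (S M)) as [->|]; auto.
        eapply Rle_trans; [apply H; auto; lia|auto].
      + exists j, t; split; [auto|split; [auto|]]. intros i s Hi Hs.
        destruct (Nat.eq_dec i (S M)) as [->|].
        * eapply Rle_trans; [apply H'; auto|lra].
        * apply H; auto; lia. }
  destruct N; [lia|]. apply (H2 N); auto.
Qed.

Lemma trajectory_speed N om ka th i s t : (1 <= N)%nat -> 0 < ka -> (i < N)%nat ->
  trajectory N om ka th -> 0 <= s -> 0 <= t ->
  Rabs (th t i - th s i) <= (rsum N (fun j => Rabs (om j)) + 2 * ka) * Rabs (t - s).
Proof.
  intros HN Hka Hi [Hc Hd] Hs Ht.
  destruct (mean_value (fun t => th t i) (fun t => winfree_rhs N om ka (th t) i) s t)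
    as [c [_ E]]; auto.
  { intros x Hx. apply Hd; auto. unfold Rmin in Hx; destruct Rle_dec; lra. }
  rewrite E. apply Rabs_mult_le; [apply rhs_bound; auto|lra].
Qed.

(** This is the estimate that [sweep] asks for when it replaces coordinate [i]: the coordinates
    below [i] are already compared at time 0, those above [i] still at time [h]. The factor on the
    diagonal is exact to first order in [h]; the factor of [e] need not be small, because [e] is
    made small by cutting. *)
Lemma trajectory_pair N om ka : (1 <= N)%nat -> 0 < ka ->
  exists K h0, 0 <= K /\ 0 < h0 <= 1 /\ forall h z u v i e,
  0 < h <= h0 -> trajectory N om ka u -> trajectory N om ka v -> (i < N)%nat ->
  (forall j, (j < N)%nat -> Rabs (u h j - z j) <= h) ->
  (forall j, (j < N)%nat -> Rabs (v h j - z j) <= h) ->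
  (forall j, (j < N)%nat -> j <> i ->
     Rabs (mixed (u 0) (u h) i j - mixed (v 0) (v h) i j) <= e) -> 0 <= e ->
  Rabs (u 0 i - v 0 i) <=
    (1 - h * rhs_diag N ka z i + K * h ^ 2) * Rabs (u h i - v h i) + (ka + K) * e.
Proof.
  intros HN Hka. set (W := rsum N (fun j => Rabs (om j)) + 2 * ka).
  assert (HW : 0 <= W).
  { unfold W. assert (0 <= rsum N (fun j => Rabs (om j))); [|lra].
    apply rsum_nonneg; intros; apply Rabs_pos. }
  (* In [12 ka^2], [3 ka^2] comes from the drift of the other coordinates and [9 ka^2] from
     replacing [d c i] by [d h i]; the last term is the linearization error at radius
     [(1 + W) h]. *)
  set (K1 := 12 * ka ^ 2 + 5 * ka * (1 + W)).
  assert (HK1 : 0 <= K1).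
  { unfold K1. assert (0 <= ka ^ 2) by apply pow2_ge_0.
    assert (0 <= ka * (1 + W)) by (apply Rmult_le_pos; lra). lra. }
  exists (2 * K1), (/ (1 + 6 * ka)). split; [lra|]. split.
  { split; [apply Rinv_0_lt_compat; lra|]. rewrite <- Rinv_1. apply Rinv_le_contravar; lra. }
  intros h z u v i e Hh Tu Tv Hi Hu Hv He He0.
  (* Over the time [h] a difference varies by at most [3 ka D h], hence by at most [D / 2]. *)
  assert (Hkh : 6 * ka * h <= 1).
  { destruct Hh as [Hh1 Hh2]. apply (Rmult_le_compat_l (1 + 6 * ka)) in Hh2; [|lra].
    rewrite Rinv_r in Hh2 by lra. lra. }
  assert (Hh1 : h <= 1).
  { eapply Rle_trans; [apply Hh|]. rewrite <- Rinv_1. apply Rinv_le_contravar; lra. }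
  set (d := fun t j => u t j - v t j).
  assert (Hcd : forall j, (j < N)%nat -> forall t, continuity_pt (fun s => d s j) t).
  { intros j Hj t. apply continuity_pt_minus; [apply Tu|apply Tv]; auto. }
  assert (Hdd : forall j, (j < N)%nat -> forall t, 0 < t -> is_derive (fun s => d s j) t
     (winfree_rhs N om ka (u t) j - winfree_rhs N om ka (v t) j)).
  { intros j Hj t Ht.
    apply (is_derive_minus (fun s => u s j) (fun s => v s j)); [apply Tu|apply Tv]; auto. }
  destruct (sup_dist_attained N d h HN (Rlt_le _ _ (proj1 Hh)) Hcd) as [js [ts [Hjs [Hts Hmax]]]].
  set (D := Rabs (d ts js)) in *.
  assert (HD : 0 <= D) by apply Rabs_pos.
  assert (Hvar : forall j s t, (j < N)%nat -> 0 <= s <= h -> 0 <= t <= h ->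
     Rabs (d t j - d s j) <= 3 * ka * D * h).
  { intros j s t Hj Hs Ht.
    destruct (mean_value (fun s => d s j)
      (fun t => winfree_rhs N om ka (u t) j - winfree_rhs N om ka (v t) j) s t) as [c [Hc E]]; auto.
    { intros x Hx. apply Hdd; auto. unfold Rmin in Hx; destruct Rle_dec; lra. }
    rewrite E. apply Rabs_mult_le.
    - apply rhs_lip; auto. intros k Hk. apply (Hmax k c Hk).
      unfold Rmin, Rmax in Hc; destruct Rle_dec; lra.
    - apply Rabs_le; lra. }
  assert (Hvar' : forall j s t, (j < N)%nat -> 0 <= s <= h -> 0 <= t <= h ->
     Rabs (d t j) <= Rabs (d s j) + 3 * ka * D * h).
  { intros j s t Hj Hs Ht. specialize (Hvar j s t Hj Hs Ht).
    generalize (Rabs_triang_inv (d t j) (d s j)); lra. }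
  assert (Hmix : forall j, (j < N)%nat -> j <> i -> forall t, 0 <= t <= h ->
     Rabs (d t j) <= e + 3 * ka * D * h).
  { intros j Hj Hji t Ht. specialize (He j Hj Hji). unfold mixed in He.
    destruct (Nat.ltb j i).
    - fold (d 0 j) in He. assert (H := Hvar' j 0 t Hj ltac:(lra) Ht). lra.
    - fold (d h j) in He. assert (H := Hvar' j h t Hj ltac:(lra) Ht). lra. }
  assert (H6 : 6 * ka * h * D <= 1 * D) by (apply Rmult_le_compat_r; auto).
  (* Absorption: the maximum is attained either in coordinate [i], close to its value at time [h],
     or in another one, controlled by [e]; in both cases the excess is at most [D / 2]. *)
  assert (HD2 : D <= 2 * (Rabs (d h i) + e)).
  { assert (0 <= Rabs (d h i)) by apply Rabs_pos. destruct (Nat.eq_dec js i) as [E|E].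
    - assert (H' := Hvar' js h ts Hjs ltac:(lra) Hts). rewrite E in H' at 2.
      fold D in H'. lra.
    - assert (H' := Hmix js Hjs E ts Hts). fold D in H'. lra. }
  destruct (mean_value (fun s => d s i)
      (fun t => winfree_rhs N om ka (u t) i - winfree_rhs N om ka (v t) i) 0 h) as [c [Hc E]]; auto.
  { intros x Hx. apply Hdd; auto. unfold Rmin in Hx; destruct Rle_dec; lra. }
  rewrite Rmin_left, Rmax_right in Hc by lra.
  assert (Hnear : forall w, trajectory N om ka w ->
     (forall j, (j < N)%nat -> Rabs (w h j - z j) <= h) ->
     forall j, (j < N)%nat -> Rabs (w c j - z j) <= (1 + W) * h).
  { intros w Tw Hw j Hj.
    assert (H := trajectory_speed N om ka w j h c HN Hka Hj Tw ltac:(lra) ltac:(lra)).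
    fold W in H. specialize (Hw j Hj).
    assert (W * Rabs (c - h) <= W * h) by (apply Rmult_le_compat_l; auto; apply Rabs_le; lra).
    replace (w c j - z j) with ((w c j - w h j) + (w h j - z j)) by ring.
    eapply Rle_trans; [apply Rabs_triang|]. lra. }
  assert (Hlin := rhs_linear N om ka (u c) (v c) z ((1 + W) * h) (e + 3 * ka * D * h) i HN Hka Hi
    (Hnear u Tu Hu) (Hnear v Tv Hv) (fun j Hj Hji => Hmix j Hj Hji c Hc)).
  assert (H0 : 0 <= ka * D * h) by (repeat apply Rmult_le_pos; lra).
  specialize (Hlin ltac:(lra)). fold (d c i) in Hlin.
  set (A := rhs_diag N ka z i) in *.
  assert (HA : Rabs A <= 3 * ka) by (apply rhs_diag_bound; auto).
  set (G := winfree_rhs N om ka (u c) i - winfree_rhs N om ka (v c) i) in *.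
  assert (HG : Rabs (G - A * d h i) <= ka * e + h * D * K1).
  { replace (G - A * d h i) with ((G - A * d c i) + A * (d c i - d h i)) by ring.
    eapply Rle_trans; [apply Rabs_triang|].
    assert (H1 := Rabs_mult_le _ _ _ _ HA (Hvar i h c Hi ltac:(lra) Hc)).
    assert (H2 : ka * (5 * ((1 + W) * h) * Rabs (d c i)) <= ka * (5 * ((1 + W) * h) * D)).
    { apply Rmult_le_compat_l; [lra|]. apply Rmult_le_compat_l; [|auto].
      apply Rmult_le_pos; [lra|]. apply Rmult_le_pos; lra. }
    rewrite Rmult_plus_distr_l in Hlin. unfold K1.
    replace (ka * e + h * D * (12 * ka ^ 2 + 5 * ka * (1 + W))) with
      (ka * (e + 3 * ka * D * h) + ka * (5 * ((1 + W) * h) * D) + 3 * ka * (3 * ka * D * h))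
      by ring. lra. }
  change (u 0 i - v 0 i) with (d 0 i). change (u h i - v h i) with (d h i).
  replace (d 0 i) with ((1 - h * A) * d h i - h * (G - A * d h i)).
  2:{ rewrite Rminus_0_r in E. lra. }
  unfold Rminus at 1. eapply Rle_trans; [apply Rabs_triang|]. rewrite Rabs_Ropp, !Rabs_mult.
  rewrite (Rabs_pos_eq h) by lra.
  rewrite (Rabs_pos_eq (1 - h * A)).
  2:{ apply Rabs_le_between in HA.
      assert (h * A <= h * (3 * ka)) by (apply Rmult_le_compat_l; lra). lra. }
  assert (H7 : h * Rabs (G - A * d h i) <= h * (ka * e + h * D * K1))
    by (apply Rmult_le_compat_l; lra).
  assert (H8 : h * (h * D * K1) <= h * (h * (2 * (Rabs (d h i) + e)) * K1)).
  { apply Rmult_le_compat_l; [lra|]. apply Rmult_le_compat_r; [lra|].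
    apply Rmult_le_compat_l; lra. }
  assert (H9 : h * (ka * e) <= 1 * (ka * e)) by (apply Rmult_le_compat_r; [apply Rmult_le_pos|]; lra).
  assert (H10 : h * h * (2 * e * K1) <= 1 * 1 * (2 * e * K1)).
  { apply Rmult_le_compat_r; [repeat apply Rmult_le_pos; lra|]. apply Rmult_le_compat; lra. }
  simpl. rewrite Rmult_1_r. lra.
Qed.

(** * The volume argument *)

Lemma sin_cos_period_Z x k :
  sin (x + 2 * PI * IZR k) = sin x /\ cos (x + 2 * PI * IZR k) = cos x.
Proof.
  assert (Hn : forall x n, sin (x + 2 * PI * INR n) = sin x /\ cos (x + 2 * PI * INR n) = cos x).
  { intros y n. replace (y + 2 * PI * INR n) with (y + 2 * INR n * PI) by ring.
    split; [apply sin_period|apply cos_period]. }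
  destruct (Z.le_ge_cases 0 k) as [H|H].
  - rewrite <- (Z2Nat.id k) by auto. rewrite <- INR_IZR_INZ. auto.
  - destruct (Hn (x + 2 * PI * IZR k) (Z.to_nat (- k))) as [H1 H2].
    rewrite INR_IZR_INZ, Z2Nat.id, opp_IZR in H1, H2 by lia.
    replace (x + 2 * PI * IZR k + 2 * PI * - IZR k) with x in H1, H2 by ring. auto.
Qed.

Definition period_index (x : R) : Z := (- Int_part (x / (2 * PI)))%Z.

Lemma period_index_spec x : 0 <= x + 2 * PI * IZR (period_index x) < 2 * PI.
Proof.
  unfold period_index. rewrite opp_IZR. generalize (base_Int_part (x / (2 * PI))).
  set (n := IZR _). intros [H1 H2]. assert (HP := PI_RGT_0).
  assert (E : x = 2 * PI * (x / (2 * PI))) by (field; lra).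
  set (y := x / (2 * PI)) in *. clearbody y n. subst x.
  assert (0 <= 2 * PI * (y - n) < 2 * PI * 1); [|lra]. split.
  - apply Rmult_le_pos; lra.
  - apply Rmult_lt_compat_l; lra.
Qed.

(** Covering modulo [2 pi] in each coordinate: boxes stay in [R^N], and an integer vector moves the
    point into one of them. *)
Definition covm (N : nat) (L : list box) (x : nat -> R) : Prop :=
  exists k : nat -> Z, cov N L (fun i => x i + 2 * PI * IZR (k i)).

(** With the lower end reduced to [[0, 2 pi)] and a side at most [2 pi], only the translates by
    [2 pi q] with [-m-1 <= q <= m] can meet [[-2 pi m, 2 pi m]]: there are [2 m + 2] of them,
    indexed by [n = q + m + 1]. *)
Lemma unfold_coordinate N m j b : (j < N)%nat -> pos_box N b -> snd b j <= 2 * PI ->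
  exists L, (forall b', In b' L -> snd b' = snd b) /\
    tvol N L <= INR (2 * m + 2) * vol N b /\
    forall x k, Rabs (x j) <= 2 * PI * INR m -> in_box N b (upd x j (x j + 2 * PI * IZR k)) ->
      cov N L x.
Proof.
  intros Hj Hb Hl. assert (HP := PI_RGT_0).
  set (al := fst b j + 2 * PI * IZR (period_index (fst b j))).
  assert (Hal : 0 <= al < 2 * PI) by apply period_index_spec.
  exists (map (fun n => (upd (fst b) j (al + 2 * PI * (INR n - INR m - 1)), snd b))
    (seq 0 (2 * m + 2))). split; [|split].
  - intros b' Hb'. apply in_map_iff in Hb'. destruct Hb' as [n [<- _]]; auto.
  - rewrite (tvol_map_const N _ _ (vol N b)); [rewrite length_seq; lra|]. intros; auto.
  - intros x k Hx Hin.
    set (q := (- k - period_index (fst b j))%Z).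
    assert (Hq : al + 2 * PI * IZR q <= x j <= al + 2 * PI * IZR q + snd b j).
    { specialize (Hin j Hj). rewrite upd_same in Hin.
      unfold q, al. rewrite minus_IZR, opp_IZR. lra. }
    apply Rabs_le_between in Hx.
    assert (Hq1 : (q <= Z.of_nat m)%Z).
    { apply le_IZR. rewrite <- INR_IZR_INZ. apply (Rmult_le_reg_l (2 * PI)); lra. }
    assert (Hq2 : (- Z.of_nat m - 2 < q)%Z).
    { apply lt_IZR. rewrite minus_IZR, opp_IZR, <- INR_IZR_INZ.
      apply (Rmult_lt_reg_l (2 * PI)); lra. }
    eexists; split.
    + apply in_map_iff. exists (Z.to_nat (q + Z.of_nat m + 1)). split; [reflexivity|].
      apply in_seq. lia.
    + assert (E : INR (Z.to_nat (q + Z.of_nat m + 1)) = IZR q + INR m + 1).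
      { rewrite INR_IZR_INZ, Z2Nat.id, !plus_IZR, <- INR_IZR_INZ by lia. ring. }
      intros i Hi; simpl. rewrite E. destruct (Nat.eq_dec i j) as [->|Hij].
      * rewrite upd_same. replace (IZR q + INR m + 1 - INR m - 1) with (IZR q) by ring. auto.
      * rewrite upd_other by auto. specialize (Hin i Hi). rewrite upd_other in Hin by auto. auto.
Qed.

(** Periods are undone one coordinate at a time: in the [M]-th state the first [M] coordinates are
    those of the point itself and the others still carry their integer shift. *)
Lemma cov_of_covm N m L :
  (forall b, In b L -> pos_box N b /\ forall i, (i < N)%nat -> snd b i <= 2 * PI) ->
  exists L', (forall b, In b L' -> pos_box N b) /\
    tvol N L' <= INR (2 * m + 2) ^ N * tvol N L /\
    forall x, (forall i, (i < N)%nat -> Rabs (x i) <= 2 * PI * INR m) -> covm N L x -> cov N L' x.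
Proof.
  intros HL.
  set (Q := fun b => pos_box N b /\ forall i, (i < N)%nat -> snd b i <= 2 * PI).
  set (T := ((nat -> R) * (nat -> Z))%type).
  set (y := fun s : T => fun i => fst s i + 2 * PI * IZR (snd s i)).
  set (X := fun s : T => forall i, (i < N)%nat -> Rabs (fst s i) <= 2 * PI * INR m).
  assert (H : forall M, (M <= N)%nat -> exists L', (forall b, In b L' -> Q b) /\
    tvol N L' <= INR (2 * m + 2) ^ M * tvol N L /\
    forall s, X s -> cov N L (y s) -> cov N L' (mixed (fst s) (y s) M)).
  { induction M as [|M IH]; intros HM.
    - exists L; split; [auto|split; [simpl; lra|]]. intros s _ Hs; exact Hs.
    - destruct IH as [L1 [Q1 [V1 C1]]]; [lia|].
      destruct (cover_bind N T X (fun s => mixed (fst s) (y s) M)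
        (fun s => mixed (fst s) (y s) (S M)) Q (INR (2 * m + 2)) L1) as [L' [Q' [V' C']]].
      + intros b Hb. destruct (Q1 b Hb) as [Pb Sb].
        destruct (unfold_coordinate N m M b HM Pb (Sb M HM)) as [L' [S' [V' C']]].
        exists L'. split; [|split; [auto|]].
        * intros b' Hb'. unfold Q, pos_box. rewrite (S' b' Hb'). split; auto.
        * intros s Xs Hs. apply (C' _ (snd s M)).
          -- unfold mixed. destruct (Nat.ltb_spec M (S M)); [apply Xs; auto|lia].
          -- eapply in_box_ext; [|exact Hs]. intros i Hi. unfold mixed, y.
             destruct (Nat.eq_dec i M) as [->|HiM].
             ++ rewrite upd_same. destruct (Nat.ltb_spec M M), (Nat.ltb_spec M (S M)); auto; lia.
             ++ rewrite upd_other by auto.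
                destruct (Nat.ltb_spec i M), (Nat.ltb_spec i (S M)); auto; lia.
      + exists L'; split; [auto|split; [|auto]]. eapply Rle_trans; [exact V'|]. simpl pow.
        rewrite Rmult_assoc. apply Rmult_le_compat_l; [apply pos_INR|auto]. }
  destruct (H N (Nat.le_refl _)) as [L' [Q' [V' C']]].
  exists L'; split; [intros; apply Q'; auto|split; [auto|]].
  intros x Hx [k Hk]. specialize (C' (x, k) Hx Hk). eapply cov_ext; [|exact C'].
  intros i Hi. unfold mixed. destruct (Nat.ltb_spec i N); [auto|lia].
Qed.

Lemma covm_full N x :
  covm N [((fun _ => 0), (fun _ => 2 * PI))] x.
Proof.
  exists (fun i => period_index (x i)). eexists; split; [left; reflexivity|].
  intros i Hi; simpl. generalize (period_index_spec (x i)); lra.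
Qed.

(** The exceptional set where the retained part of the divergence vanishes: modulo [2 pi] it lies in
    three slabs of thickness [2 pi e] starting at 0, [pi] and [2 pi]. *)
Lemma covm_sin_zero N d : (1 <= N)%nat -> 0 < d ->
  exists L, (forall b, In b L -> pos_box N b /\ forall i, (i < N)%nat -> snd b i <= 2 * PI) /\
    tvol N L <= d /\ forall x, sin (x O) = 0 -> covm N L x.
Proof.
  intros HN Hd. assert (HP := PI_RGT_0).
  set (v := rprod N (fun _ => 2 * PI)).
  assert (Hv : 0 < v) by (apply rprod_pos; intros; lra).
  set (e := Rmin 1 (d / (3 * v))).
  assert (He : 0 < e <= 1).
  { unfold e; split; [apply Rmin_glb_lt; [lra|apply Rdiv_lt_0_compat; lra]|apply Rmin_l]. }
  assert (Hev : 3 * (e * v) <= d).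
  { assert (e <= d / (3 * v)) by apply Rmin_r.
    apply (Rmult_le_compat_r (3 * v)) in H; [|lra].
    replace (d / (3 * v) * (3 * v)) with d in H by (field; lra). lra. }
  exists (map (fun a => (upd (fun _ => 0) O a, upd (fun _ => 2 * PI) O (e * (2 * PI))))
    [0; PI; 2 * PI]). split; [|split].
  - intros b Hb. apply in_map_iff in Hb. destruct Hb as [a [<- _]]. unfold pos_box; simpl.
    assert (0 < e * (2 * PI)) by (apply Rmult_lt_0_compat; lra).
    assert (e * (2 * PI) <= 1 * (2 * PI)) by (apply Rmult_le_compat_r; lra).
    split; intros i Hi; (destruct (Nat.eq_dec i O) as [->|];
      [rewrite upd_same; lra|rewrite upd_other by auto; lra]).
  - rewrite (tvol_map_const N _ _ (e * v)); [simpl; lra|].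
    intros a _. unfold vol; simpl. rewrite (rprod_upd_scal N (fun _ => 2 * PI)) by lia. auto.
  - intros x Hx. exists (fun i => period_index (x i)).
    set (y := fun i => x i + 2 * PI * IZR (period_index (x i))).
    assert (Hs : forall i, 0 <= y i < 2 * PI) by (intros; apply period_index_spec).
    assert (Ha : In (y O) [0; PI; 2 * PI]).
    { destruct (sin_cos_period_Z (x O) (period_index (x O))) as [H1 _]. rewrite Hx in H1.
      change (sin (y O) = 0) in H1. specialize (Hs O).
      destruct (sin_eq_O_2PI_0 (y O)) as [H|[H|H]]; auto; try lra; rewrite H; simpl; auto. }
    eexists; split; [apply in_map_iff; exists (y O); split; [reflexivity|exact Ha]|].
    intros i Hi; simpl. change (x i + 2 * PI * IZR (period_index (x i))) with (y i).
    destruct (Nat.eq_dec i O) as [->|].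
    + rewrite !upd_same. assert (0 < e * (2 * PI)) by (apply Rmult_lt_0_compat; lra). lra.
    + rewrite !upd_other by auto. specialize (Hs i). lra.
Qed.

(** * Data whose order parameter never exceeds 1 *)

Definition low_trajectory (N : nat) (om : nat -> R) (ka : R) (th : R -> nat -> R) : Prop :=
  trajectory N om ka th /\ forall t, 0 < t -> order_param N (th t) <= 1.

(** A point counts as soon as some trajectory from it stays low; outside this set every solution has
    a time with [R > 1], as the theorem requires for every [theta]. *)
Definition low_start (N : nat) (om : nat -> R) (ka : R) (x : nat -> R) : Prop :=
  exists th, low_trajectory N om ka th /\ forall i, (i < N)%nat -> th 0 i = x i.

(** Forward invariance: a cover of the low starts also covers the positions of low trajectories at
    time [h]. *)
Lemma low_trajectory_shift N om ka th h : 0 <= h -> low_trajectory N om ka th ->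
  low_trajectory N om ka (fun t => th (t + h)).
Proof.
  intros Hh [[Hc Hd] Hl]. split; [split|].
  - intros i Hi t. apply (continuity_pt_comp (fun s => s + h) (fun s => th s i)).
    + apply continuity_pt_plus; [apply derivable_continuous_pt, derivable_pt_id|].
      apply continuity_pt_const; intros ? ?; auto.
    + apply Hc; auto.
  - intros t Ht i Hi.
    assert (H := is_derive_comp (fun s => th s i) (fun s => s + h) t _ 1 (Hd (t + h) ltac:(lra) i Hi)).
    unfold scal in H; simpl in H; unfold mult in H; simpl in H. rewrite Rmult_1_l in H. apply H.
    auto_derive; auto.
  - intros t Ht. apply Hl; lra.
Qed.

Lemma order_param_ext N u v : (forall j, (j < N)%nat -> cos (u j) = cos (v j)) ->
  order_param N u = order_param N v.
Proof. intros H. unfold order_param. f_equal. apply rsum_ext; intros; rewrite H; auto. Qed.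

(** Moves a whole trajectory by the integer vector that brings its position at time [h] into a box,
    so that pulling back needs no reduction modulo [2 pi]. *)
Lemma low_trajectory_translate N om ka th (k : nat -> Z) : low_trajectory N om ka th ->
  low_trajectory N om ka (fun t i => th t i + 2 * PI * IZR (k i)).
Proof.
  intros [[Hc Hd] Hl].
  assert (HR : forall t, order_param N (fun i => th t i + 2 * PI * IZR (k i)) =
    order_param N (th t)).
  { intros t. apply order_param_ext. intros; apply sin_cos_period_Z. }
  split; [split|].
  - intros i Hi t. apply continuity_pt_plus; [apply Hc; auto|].
    apply continuity_pt_const; intros ? ?; auto.
  - intros t Ht i Hi. specialize (Hd t Ht i Hi). rewrite rhs_order_param in *.
    rewrite HR, (proj1 (sin_cos_period_Z (th t i) (k i))).
    rewrite <- (Rplus_0_r (om i - _)).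
    apply (is_derive_plus (fun s => th s i) (fun _ => 2 * PI * IZR (k i))); auto.
    exact (@is_derive_const R_AbsRing R_NormedModule (2 * PI * IZR (k i)) t).
  - intros t Ht. rewrite HR. auto.
Qed.

Lemma sin_sqr_lip a b : Rabs (sin a ^ 2 - sin b ^ 2) <= 2 * Rabs (a - b).
Proof.
  replace (sin a ^ 2 - sin b ^ 2) with ((sin a + sin b) * (sin a - sin b)) by ring.
  apply Rabs_mult_le; [|apply sin_lip]. eapply Rle_trans; [apply Rabs_triang|].
  generalize (Rabs_sin_le a) (Rabs_sin_le b); lra.
Qed.

(* The contraction rate is the divergence of the field, which is at least
   [ka / N * sin^2] of the first angle where [R <= 1]. *)
Lemma box_backward N om ka : (1 <= N)%nat -> 0 < ka ->
  exists K h0, 0 <= K /\ 0 < h0 <= 1 /\ forall h b th0,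
  0 < h <= h0 -> pos_box N b -> (forall i, (i < N)%nat -> snd b i <= h) ->
  low_trajectory N om ka th0 -> in_box N b (th0 h) ->
  exists L, (forall b', In b' L -> pos_box N b') /\
    tvol N L <= (1 - h * (ka / INR N * sin (th0 h O) ^ 2) + K * h ^ 2) * vol N b /\
    forall th, low_trajectory N om ka th -> in_box N b (th h) -> cov N L (th 0).
Proof.
  intros HN Hka. destruct (trajectory_pair N om ka HN Hka) as [K1 [h1 [HK1 [Hh1 Hpair]]]].
  destruct (rprod_expand N (3 * ka + (K1 + 1))) as [K2 [HK2 Hprod]]; [lra|].
  assert (HN0 : 0 <= INR N) by apply pos_INR.
  (* [N (K1 + 1)] sums the second-order parts of the diagonal factors and [K2] is the error of
     expanding their product. The second bound on [h] keeps each factor [1 - h * A i] positive. *)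
  exists (INR N * (K1 + 1) + K2), (Rmin h1 (/ (1 + 6 * ka))).
  assert (Hk : 0 < / (1 + 6 * ka)) by (apply Rinv_0_lt_compat; lra).
  split; [assert (0 <= INR N * (K1 + 1)) by (apply Rmult_le_pos; lra); lra|].
  split.
  { split; [apply Rmin_glb_lt; lra|]. eapply Rle_trans; [apply Rmin_l|lra]. }
  intros h b th0 [Hh Hh'] Hb Hs Hlow0 Hin0.
  assert (Hhh1 : h <= h1) by (eapply Rle_trans; [exact Hh'|apply Rmin_l]).
  assert (Hkh : 3 * ka * h < 1).
  { assert (H : h <= / (1 + 6 * ka)) by (eapply Rle_trans; [exact Hh'|apply Rmin_r]).
    apply (Rmult_le_compat_l (1 + 6 * ka)) in H; [|lra].
    rewrite Rinv_r in H by lra. assert (0 < ka * h) by (apply Rmult_lt_0_compat; auto). lra. }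
  (* The base point is the position of a low trajectory, hence has [R <= 1]; the trace bound is
     needed at this one point of the box only. *)
  set (z := th0 h). set (A := rhs_diag N ka z).
  assert (HA : forall i, Rabs (A i) <= 3 * ka) by (intros; apply rhs_diag_bound; auto).
  assert (Hh2 : 0 < h ^ 2) by (apply pow_lt; auto).
  (* The slack of each sweep step is taken as [h ^ 2], which is absorbed in the second-order
     error. *)
  destruct (sweep N (R -> nat -> R) (fun th => low_trajectory N om ka th /\ in_box N b (th h))
    (fun th => th 0) (fun th => th h) (fun i => 1 - h * A i + K1 * h ^ 2) (ka + K1) (h ^ 2) b)
    as [L [PL [VL CL]]]; auto.
  - intros i Hi. specialize (HA i). apply Rabs_le_between in HA.
    assert (h * A i <= h * (3 * ka)) by (apply Rmult_le_compat_l; lra).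
    assert (0 <= K1 * h ^ 2) by (apply Rmult_le_pos; lra). lra.
  - lra.
  - intros i s t d Hi [[Ts _] Is] [[Tt _] It] Hd Hmix.
    assert (Hnear : forall w, in_box N b (w h) -> forall j, (j < N)%nat -> Rabs (w h j - z j) <= h).
    { intros w Hw j Hj. specialize (Hw j Hj). specialize (Hin0 j Hj). specialize (Hs j Hj).
      unfold z. apply Rabs_le. lra. }
    apply (Hpair h z s t i d); auto; lra.
  - exists L; split; [auto|split; [|intros; apply CL; auto]].
    eapply Rle_trans; [exact VL|]. apply Rmult_le_compat_r.
    { left; apply vol_pos; auto. }
    set (u := fun i => - A i + (K1 + 1) * h).
    assert (Hu : rprod N (fun i => 1 - h * A i + K1 * h ^ 2 + h ^ 2) =
      rprod N (fun i => 1 + h * u i)).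
    { apply rprod_ext; intros; unfold u; ring. }
    rewrite Hu. specialize (Hprod h u ltac:(lra)).
    assert (HuB : forall i, (i < N)%nat -> Rabs (u i) <= 3 * ka + (K1 + 1)).
    { intros i _. unfold u. eapply Rle_trans; [apply Rabs_triang|]. rewrite Rabs_Ropp.
      specialize (HA i). assert ((K1 + 1) * h <= (K1 + 1) * 1) by (apply Rmult_le_compat_l; lra).
      rewrite (Rabs_pos_eq ((K1 + 1) * h)); [lra|]. apply Rmult_le_pos; lra. }
    specialize (Hprod HuB). apply Rabs_le_between in Hprod.
    assert (Hsum : rsum N u = - rsum N A + INR N * ((K1 + 1) * h)).
    { unfold u. rewrite rsum_plus, rsum_const. f_equal.
      rewrite (rsum_ext _ _ (fun i => (-1) * A i)), rsum_scal; [ring|intros; ring]. }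
    rewrite Hsum in Hprod.
    assert (Htr := rhs_trace N ka z HN Hka (proj2 Hlow0 h Hh)). fold A in Htr. fold z.
    assert (h * (ka / INR N * sin (z O) ^ 2) <= h * rsum N A)
      by (apply Rmult_le_compat_l; lra).
    lra.
Qed.

Lemma glb_exists (S : R -> Prop) : (exists v, S v) -> (forall v, S v -> 0 <= v) ->
  exists J, 0 <= J /\ (forall v, S v -> J <= v) /\ forall eps, 0 < eps -> exists v, S v /\ v < J + eps.
Proof.
  intros [v0 H0] Hpos. destruct (completeness (fun v => S (- v))) as [m [Hm1 Hm2]].
  - exists 0. intros v Hv. specialize (Hpos _ Hv). lra.
  - exists (- v0). rewrite Ropp_involutive; auto.
  - exists (- m). split; [|split].
    + assert (m <= 0); [|lra]. apply Hm2. intros v Hv. specialize (Hpos _ Hv). lra.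
    + intros v Hv. assert (- v <= m); [|lra]. apply Hm1. rewrite Ropp_involutive; auto.
    + intros eps Heps. apply NNPP. intros Hn.
      assert (m <= m - eps); [|lra]. apply Hm2. intros v Hv.
      destruct (Rle_dec v (m - eps)); auto. exfalso; apply Hn. exists (- v); split; auto. lra.
Qed.

(* Let [J] be the infimum of the volumes of finite covers of the set modulo [2 pi].  A cover of
   volume at most [J + h^2], pulled back by time [h], is again a cover, hence has volume at least
   [J]; so the boxes that are contracted by a factor [1 - g h] have total volume [O(h)]. *)
Lemma low_start_sin_null N om ka eta eps : (1 <= N)%nat -> 0 < ka -> 0 < eta -> 0 < eps ->
  exists L, (forall b, In b L -> pos_box N b /\ forall i, (i < N)%nat -> snd b i <= 2 * PI) /\
    tvol N L <= eps /\
    forall x, low_start N om ka x -> eta < sin (x O) ^ 2 -> covm N L x.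
Proof.
  intros HN Hka Heta Heps. assert (HP := PI2_1).
  assert (HN' : 0 < INR N) by (apply lt_0_INR; lia).
  destruct (box_backward N om ka HN Hka) as [K [h0 [HK [Hh0 Hbox]]]].
  set (S := fun v => exists L, (forall b, In b L -> pos_box N b) /\
    (forall x, low_start N om ka x -> covm N L x) /\ v = tvol N L).
  destruct (glb_exists S) as [J [HJ0 [HJ1 HJ2]]].
  { eexists. exists [((fun _ => 0), (fun _ => 2 * PI))]. split; [|split; [|reflexivity]].
    - intros b [<-|[]] i Hi; simpl; lra.
    - intros x _. apply covm_full. }
  { intros v [L [PL [_ ->]]]. apply tvol_nonneg; auto. }
  (* Half of [eta] is left for the variation of [sin^2] inside a box: it is 2-Lipschitz and sides
     are at most [h <= eta / 4]. *)
  set (g := ka / INR N * (eta / 2)).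
  assert (Hg : 0 < g) by (apply Rmult_lt_0_compat; [apply Rdiv_lt_0_compat|]; lra).
  (* From [J <= (1 + K h^2) (J + h^2) - h g V], with [V] the volume of the contracted boxes and
     [h <= 1], follows [g V <= h c]; the condition [h c <= eps g] then gives [V <= eps]. *)
  set (c := 1 + K * (J + 1)).
  assert (Hc : 0 < c).
  { unfold c. assert (0 <= K * (J + 1)) by (apply Rmult_le_pos; lra). lra. }
  assert (Hh : exists h, 0 < h <= h0 /\ h <= eta / 4 /\ h * g <= 1 /\ h * c <= eps * g).
  { exists (Rmin (Rmin h0 (eta / 4)) (Rmin (/ g) (eps * g / c))).
    assert (0 < / g) by (apply Rinv_0_lt_compat; auto).
    assert (0 < eps * g / c) by (apply Rdiv_lt_0_compat; auto; apply Rmult_lt_0_compat; auto).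
    set (h := Rmin _ _).
    assert (A1 : h <= Rmin h0 (eta / 4)) by apply Rmin_l.
    assert (A2 : h <= Rmin (/ g) (eps * g / c)) by apply Rmin_r.
    assert (B1 := Rmin_l h0 (eta / 4)). assert (B2 := Rmin_r h0 (eta / 4)).
    assert (B3 := Rmin_l (/ g) (eps * g / c)). assert (B4 := Rmin_r (/ g) (eps * g / c)).
    split; [split; [|lra]|split; [lra|split]].
    - unfold h. repeat apply Rmin_glb_lt; lra.
    - assert (H1 : h * g <= / g * g) by (apply Rmult_le_compat_r; lra).
      rewrite Rinv_l in H1; lra.
    - assert (H1 : h * c <= eps * g / c * c) by (apply Rmult_le_compat_r; lra).
      replace (eps * g / c * c) with (eps * g) in H1 by (field; lra). lra. }
  destruct Hh as [h [Hh1 [Hh2 [Hh3 Hh4]]]].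
  assert (Hhsq : 0 < h ^ 2) by (apply pow_lt; lra).
  destruct (HJ2 (h ^ 2) Hhsq) as [v [[L0 [PL0 [CL0 ->]]] HvJ]].
  destruct (cover_bind N _ (fun _ => True) (fun x => x) (fun x => x)
    (fun b => pos_box N b /\ forall i, (i < N)%nat -> snd b i <= h) 1 L0) as [L [PL [VL CL]]].
  { intros b Hb. destruct (box_refine N (fun _ => True) h b) as [L [V [C G]]]; auto; [lra|].
    exists L; split; [|split; [lra|auto]]. intros b' Hb'. destruct (G b' Hb') as [G1 G2].
    split; auto. intros i Hi; apply G2; auto. }
  assert (Hh2' : h ^ 2 <= 1) by (simpl; assert (h * h <= 1 * 1) by (apply Rmult_le_compat; lra); lra).
  destruct (cover_bind_gain N (R -> nat -> R) (low_trajectory N om ka)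
    (fun th => th h) (fun th => th 0)
    (fun b => exists e, in_box N b e /\ eta < sin (e O) ^ 2) (1 + K * h ^ 2) (h * g) L)
    as [L1 [L' [S1 [S2 [P' [V' C']]]]]].
  { intros b Hb. destruct (PL b Hb) as [Pb Sb].
    assert (Hvb : 0 < vol N b) by (apply vol_pos; auto).
    assert (HKh : 0 <= K * h ^ 2) by (apply Rmult_le_pos; lra).
    destruct (classic (exists th, low_trajectory N om ka th /\ in_box N b (th h)))
      as [[th0 [T0 I0]]|Hn].
    - destruct (Hbox h b th0 Hh1 Pb Sb T0 I0) as [L2 [P2 [V2 C2]]].
      assert (Hkn : 0 < ka / INR N) by (apply Rdiv_lt_0_compat; auto).
      exists L2; split; [auto|split; [|split; [|auto]]].
      + eapply Rle_trans; [exact V2|]. apply Rmult_le_compat_r; [lra|].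
        assert (0 <= h * (ka / INR N * sin (th0 h O) ^ 2)); [|lra].
        apply Rmult_le_pos; [lra|]. apply Rmult_le_pos; [lra|apply pow2_ge_0].
      + intros [e [He Hes]]. eapply Rle_trans; [exact V2|]. apply Rmult_le_compat_r; [lra|].
        assert (h * g <= h * (ka / INR N * sin (th0 h O) ^ 2)); [|lra].
        apply Rmult_le_compat_l; [lra|]. apply Rmult_le_compat_l; [lra|].
        assert (Hd : Rabs (e O - th0 h O) <= h).
        { specialize (He O ltac:(lia)). specialize (I0 O ltac:(lia)). specialize (Sb O ltac:(lia)).
          apply Rabs_le. lra. }
        assert (Hsl := sin_sqr_lip (e O) (th0 h O)). apply Rabs_le_between in Hsl. lra.
    (* A box met by no low trajectory pulls back to nothing; [h * g <= 1] keeps the claimed volume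
       nonnegative. *)
    - exists []; split; [intros _ []|split; [|split]].
      + simpl. apply Rmult_le_pos; lra.
      + intros _. simpl. apply Rmult_le_pos; lra.
      + intros th Tth Ith. exfalso; eauto. }
  exists L1. split; [|split].
  - intros b Hb. destruct (PL b (S1 b Hb)) as [Pb Sb]. split; auto.
    intros i Hi. specialize (Sb i Hi). lra.
  - assert (HJ' : J <= tvol N L').
    { apply HJ1. exists L'; split; [auto|split; [|auto]].
      intros x [th [Tth Hx]].
      assert (E : low_start N om ka (th h)).
      { exists (fun t => th (t + h)). split; [apply low_trajectory_shift; auto; lra|].
        intros; simpl. rewrite Rplus_0_l; auto. }
      (* The integer vector found at time [h] is used at time 0 as well, on the translated
         trajectory. *)
      destruct (CL0 _ E) as [k Hk]. exists k.
      apply (cov_ext N L' (fun i => th 0 i + 2 * PI * IZR (k i))).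
      { intros i Hi. rewrite Hx; auto. }
      apply (C' (fun t i => th t i + 2 * PI * IZR (k i))).
      - apply low_trajectory_translate; auto.
      - apply CL; auto. }
    assert (HL1 : tvol N L <= J + h ^ 2) by lra.
    assert (H1 : (1 + K * h ^ 2) * tvol N L <= (1 + K * h ^ 2) * (J + h ^ 2)).
    { apply Rmult_le_compat_l; auto. assert (0 <= K * h ^ 2) by (apply Rmult_le_pos; lra). lra. }
    assert (H2 : K * h ^ 2 * (J + h ^ 2) <= K * h ^ 2 * (J + 1)).
    { apply Rmult_le_compat_l; [apply Rmult_le_pos; lra|lra]. }
    assert (H3 : h * (g * tvol N L1) <= h * (h * c)) by (unfold c; simpl in *; lra).
    apply Rmult_le_reg_l in H3; [|lra].
    apply (Rmult_le_reg_l g); auto. lra.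
  - intros x Hx Hsx. destruct (CL0 x Hx) as [k Hk]. exists k.
    destruct (CL _ I Hk) as [b [Hb Ib]]. exists b; split; auto. apply S2; auto.
    eexists; split; [exact Ib|]. simpl.
    rewrite (proj1 (sin_cos_period_Z (x O) (k O))). exact Hsx.
Qed.

(** Exhausts the low starts by bounded pieces on which [sin^2] of angle 0 is either bounded below or
    zero; each piece has finite covers of arbitrarily small volume after unfolding the periods. *)
Lemma low_start_null N om ka : (1 <= N)%nat -> 0 < ka ->
  exists E, lebesgue_null N E /\ forall x, low_start N om ka x -> E x.
Proof.
  intros HN Hka.
  set (A := fun n x => low_start N om ka x /\
    (/ INR (S n) < sin (x O) ^ 2 \/ sin (x O) = 0) /\
    forall i, (i < N)%nat -> Rabs (x i) <= 2 * PI * INR n).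
  exists (fun x => exists n, A n x). split.
  - apply lebesgue_null_of_finite_covers; auto. intros n eps Heps.
    assert (Hn : 0 < INR (2 * n + 2) ^ N) by (apply pow_lt, lt_0_INR; lia).
    (* Unfolding multiplies volumes by at most [(2 n + 2) ^ N], and two covers share the budget. *)
    set (e := eps / INR (2 * n + 2) ^ N / 2).
    assert (He : 0 < e) by (unfold e; assert (0 < eps / INR (2 * n + 2) ^ N)
      by (apply Rdiv_lt_0_compat; auto); lra).
    destruct (low_start_sin_null N om ka (/ INR (S n)) e HN Hka) as [L1 [P1 [V1 C1]]]; auto.
    { apply Rinv_0_lt_compat, lt_0_INR; lia. }
    destruct (covm_sin_zero N e HN He) as [L2 [P2 [V2 C2]]].
    destruct (cov_of_covm N n (L1 ++ L2)) as [L [P [V C]]].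
    { intros b Hb. apply in_app_or in Hb. destruct Hb; auto. }
    exists L; split; [auto|split].
    + eapply Rle_trans; [exact V|]. rewrite tvol_app.
      apply Rle_trans with (INR (2 * n + 2) ^ N * (e + e)); [apply Rmult_le_compat_l; lra|].
      unfold e. right. field. lra.
    + intros x [Hx [Hs Hb]]. apply C; auto.
      destruct Hs as [Hs|Hs]; [destruct (C1 x Hx Hs) as [k Hk]|destruct (C2 x Hs) as [k Hk]];
        exists k; apply cov_app; auto.
  - intros x Hx.
    assert (Hb : exists n1, forall i, (i < N)%nat -> Rabs (x i) <= 2 * PI * INR n1).
    { destruct (INR_unbounded (rsum N (fun i => Rabs (x i)))) as [n1 Hn1]. exists n1.
      intros i Hi. assert (Rabs (x i) <= rsum N (fun i => Rabs (x i))).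
      { apply (rsum_term N (fun i => Rabs (x i))); auto. intros; apply Rabs_pos. }
      assert (1 * INR n1 <= 2 * PI * INR n1); [|lra].
      apply Rmult_le_compat_r; [apply pos_INR|]. generalize PI2_1; lra. }
    assert (Hs : exists n2, forall n, (n2 <= n)%nat -> / INR (S n) < sin (x O) ^ 2 \/ sin (x O) = 0).
    { destruct (Req_dec (sin (x O)) 0) as [E|E]; [exists O; auto|].
      assert (Hp : 0 < sin (x O) ^ 2) by (apply pow2_gt_0; auto).
      destruct (INR_unbounded (/ (sin (x O) ^ 2))) as [n2 Hn2]. exists n2. intros n Hn. left.
      rewrite <- (Rinv_inv (sin (x O) ^ 2)). apply Rinv_lt_contravar.
      - apply Rmult_lt_0_compat; [apply Rinv_0_lt_compat; auto|apply lt_0_INR; lia].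
      - eapply Rlt_le_trans; [exact Hn2|]. apply le_INR; lia. }
    destruct Hb as [n1 Hn1]. destruct Hs as [n2 Hn2]. exists (max n1 n2). split; [auto|split].
    + apply Hn2; lia.
    + intros i Hi. eapply Rle_trans; [apply Hn1; auto|].
      apply Rmult_le_compat_l; [generalize PI2_1; lra|]. apply le_INR; lia.
Qed.

(** * Solutions with large order parameter converge *)

Lemma continuity_pt_above (f : R -> R) (v x : R) : continuity_pt f x -> v < f x ->
  exists d, 0 < d /\ forall y, Rabs (y - x) < d -> v < f y.
Proof.
  intros Hc Hv. destruct (Hc (f x - v)) as [d [Hd H]]; [lra|].
  exists d; split; auto. intros y Hy. destruct (Req_dec y x) as [->|Hn]; auto.
  specialize (H y). simpl in H. unfold R_dist in H.
  assert (HH : Rabs (f y - f x) < f x - v) by (apply H; repeat split; auto).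
  apply Rabs_lt_between in HH. lra.
Qed.

Lemma continuity_pt_below (f : R -> R) (v x : R) : continuity_pt f x -> f x < v ->
  exists d, 0 < d /\ forall y, Rabs (y - x) < d -> f y < v.
Proof.
  intros Hc Hv. destruct (continuity_pt_above (fun y => - f y) (- v) x) as [d [Hd H]].
  - apply continuity_pt_opp; auto.
  - lra.
  - exists d; split; auto. intros y Hy. specialize (H y Hy). lra.
Qed.

Lemma last_time (f : R -> R) (v a b : R) : (forall x, continuity_pt f x) ->
  a <= b -> v <= f a -> f b < v ->
  exists s, a <= s < b /\ v <= f s /\ forall t, s < t <= b -> f t < v.
Proof.
  intros Hc Hab Ha Hb.
  destruct (completeness (fun t => a <= t <= b /\ v <= f t)) as [s [Hs1 Hs2]].
  - exists b. intros t [Ht _]; lra.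
  - exists a; split; lra.
  - assert (Has : a <= s) by (apply Hs1; split; lra).
    assert (Hsb : s <= b) by (apply Hs2; intros t [Ht _]; lra).
    assert (Hfs : v <= f s).
    { destruct (Rle_dec v (f s)) as [H|H]; auto. exfalso.
      destruct (continuity_pt_below f v s (Hc s)) as [d [Hd Hdd]]; [lra|].
      assert (s <= s - d / 2); [|lra]. apply Hs2. intros t [Ht1 Ht2].
      assert (t <= s) by (apply Hs1; split; auto).
      destruct (Rle_dec t (s - d / 2)); auto. exfalso.
      specialize (Hdd t). rewrite Rabs_left1 in Hdd by lra. specialize (Hdd ltac:(lra)). lra. }
    exists s. split; [split; auto|split; auto].
    + destruct Hsb as [|E]; auto. subst; lra.
    + intros t Ht. destruct (Rlt_dec (f t) v) as [|H]; auto. exfalso.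
      assert (t <= s); [|lra]. apply Hs1; split; lra.
Qed.

(** [last_time] applied to [- f (- t)]. *)
Lemma first_time (f : R -> R) (v a b : R) : (forall x, continuity_pt f x) ->
  a <= b -> v < f a -> f b <= v ->
  exists s, a < s <= b /\ f s <= v /\ forall t, a <= t < s -> v < f t.
Proof.
  intros Hc Hab Ha Hb.
  destruct (last_time (fun t => - f (- t)) (- v) (- b) (- a)) as [s [Hs1 [Hs2 Hs3]]].
  - intros x. apply (continuity_pt_opp (fun t => f (- t))).
    apply (continuity_pt_comp Ropp f); auto.
    apply (continuity_pt_opp id), derivable_continuous_pt, derivable_pt_id.
  - lra.
  - rewrite Ropp_involutive; lra.
  - rewrite Ropp_involutive; lra.
  - exists (- s). split; [lra|split; [lra|]]. intros t Ht.
    specialize (Hs3 (- t)). rewrite Ropp_involutive in Hs3. lra.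
Qed.

(** To end below [v] the function must cross the strip [[lo, v]]. Between its last time at level [v]
    and the next time at a level [w] of the strip it lies inside, where it cannot decrease. *)
Lemma barrier (f df : R -> R) (a b lo v : R) : (forall x, continuity_pt f x) ->
  a <= b -> lo < v -> v <= f a ->
  (forall x, a < x < b -> is_derive f x (df x)) ->
  (forall x, a < x < b -> lo <= f x <= v -> 0 <= df x) -> v <= f b.
Proof.
  intros Hc Hab Hlo Ha Hd Hdf. destruct (Rle_dec v (f b)) as [|Hn]; auto. exfalso.
  destruct (last_time f v a b) as [s [Hs1 [Hs2 Hs3]]]; auto; [lra|].
  assert (Hw : lo <= Rmax (f b) lo < v /\ f b <= Rmax (f b) lo).
  { split; [split; [apply Rmax_r|apply Rmax_lub_lt; lra]|apply Rmax_l]. }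
  set (w := Rmax (f b) lo) in *.
  destruct (first_time f w s b) as [t [Ht1 [Ht2 Ht3]]]; auto; try lra.
  destruct (mean_value_lt f df s t) as [x [Hx E]]; [lra| |auto|].
  - intros; apply Hd; lra.
  - assert (0 <= df x).
    { apply Hdf; [lra|]. specialize (Ht3 x ltac:(lra)). specialize (Hs3 x ltac:(lra)). lra. }
    assert (0 <= df x * (t - s)) by (apply Rmult_le_pos; lra). lra.
Qed.

(* [c] is the positive solution of [c^2 (1 - c^2) = (M / ka)^2] with [c^2 > 1/2]. *)
Definition threshold (M ka c : R) : Prop :=
  0 < c <= 1 /\ 1 / 2 < c ^ 2 /\ M ^ 2 = ka ^ 2 * (c ^ 2 * (1 - c ^ 2)).

(** With [q] the inner root, [c^2 = 1/2 + q] and [c^2 (1 - c^2) = 1/4 - q^2]; strictness of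
    [2 M < ka] makes [q] positive, hence [c^2 > 1/2]. *)
Lemma threshold_sqrt M ka : 0 <= M -> 2 * M < ka ->
  threshold M ka (sqrt (1/2 + sqrt (1/4 - M ^ 2 / ka ^ 2))).
Proof.
  intros HM Hka. assert (Hka2 : 0 < ka ^ 2) by (apply pow_lt; lra).
  assert (Hm : 0 <= M ^ 2 / ka ^ 2 < 1 / 4).
  { split; [apply Rmult_le_pos; [apply pow2_ge_0|left; apply Rinv_0_lt_compat; auto]|].
    apply (Rmult_lt_reg_r (ka ^ 2)); auto. unfold Rdiv at 1.
    rewrite Rmult_assoc, Rinv_l by lra.
    assert ((2 * M) * (2 * M) < ka * ka) by (apply Rmult_le_0_lt_compat; lra). simpl. lra. }
  set (m := M ^ 2 / ka ^ 2) in *. set (q := sqrt (1/4 - m)).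
  assert (Hq : 0 < q) by (apply sqrt_lt_R0; lra).
  assert (Hq2 : q ^ 2 = 1/4 - m) by (apply pow2_sqrt; lra).
  assert (Hq1 : q <= 1/2).
  { apply Rsqr_incr_0; [unfold Rsqr; simpl in Hq2|lra|lra]. lra. }
  set (c := sqrt (1/2 + q)).
  assert (Hc2 : c ^ 2 = 1/2 + q) by (apply pow2_sqrt; lra).
  assert (Hc : 0 < c) by (apply sqrt_lt_R0; lra).
  split; [split; auto|split; [lra|]].
  - apply Rsqr_incr_0; [unfold Rsqr; simpl in Hc2|lra|lra]. lra.
  - rewrite Hc2. replace ((1/2 + q) * (1 - (1/2 + q))) with (1/4 - q ^ 2) by field.
    rewrite Hq2. unfold m. field. lra.
Qed.

(** * Persistence of a large order parameter and trapping of the angles *)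

Lemma order_param_continuous N om ka th : trajectory N om ka th ->
  forall t, continuity_pt (fun s => order_param N (th s)) t.
Proof.
  intros [Hc _] t. unfold order_param.
  apply (continuity_pt_scal (fun s => rsum N (fun j => 1 + cos (th s j)))).
  assert (H : forall n, (n <= N)%nat ->
    continuity_pt (fun s => rsum n (fun j => 1 + cos (th s j))) t).
  { induction n; intros Hn; simpl.
    - apply continuity_pt_const; intros ? ?; auto.
    - apply continuity_pt_plus; [apply IHn; lia|].
      apply continuity_pt_plus; [apply continuity_pt_const; intros ? ?; auto|].
      apply (continuity_pt_comp (fun s => th s n) cos); [apply Hc; auto|apply continuity_cos]. }
  apply H; auto.
Qed.

Lemma is_derive_cos_comp (f : R -> R) t l : is_derive f t l ->
  is_derive (fun s => cos (f s)) t (- sin (f t) * l).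
Proof.
  intros H. replace (- sin (f t) * l) with (scal l (- sin (f t)))
    by (unfold scal; simpl; unfold mult; simpl; ring).
  apply (is_derive_comp cos f); auto. apply is_derive_cos_R.
Qed.

Lemma sin_sqr_cos_sqr x : sin x ^ 2 = 1 - cos x ^ 2.
Proof. generalize (sin2_cos2 x); unfold Rsqr; simpl; lra. Qed.

(* [cos (th i)] can only decrease while its modulus exceeds [c]. *)
Lemma cos_lower_bound N om ka th M c i t0 t1 : 0 < ka -> threshold M ka c ->
  (i < N)%nat -> Rabs (om i) <= M -> trajectory N om ka th -> 0 < t0 <= t1 ->
  (forall t, t0 < t < t1 -> c <= order_param N (th t)) ->
  cos (th t0 i) - (1 - c) <= cos (th t1 i).
Proof.
  intros Hka [Hc [Hc2 HM]] Hi Hom [Tc Td] Ht HR.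
  (* Starting from a cosine at most [-c], the claimed lower bound is at most -1. *)
  destruct (Rle_dec (cos (th t0 i)) (- c)) as [Hlow|Hlow].
  { generalize (COS_bound (th t1 i)); lra. }
  set (v := Rmin (cos (th t0 i)) c).
  assert (Hv : cos (th t0 i) - (1 - c) <= v).
  { unfold v. apply Rmin_glb; [lra|]. generalize (COS_bound (th t0 i)); lra. }
  apply Rle_trans with v; auto.
  apply (barrier (fun s => cos (th s i)) (fun s => - sin (th s i) * winfree_rhs N om ka (th s) i)
    t0 t1 (- c) v).
  - intros x. apply (continuity_pt_comp (fun s => th s i) cos); [apply Tc; auto|apply continuity_cos].
  - lra.
  - unfold v. apply Rmin_glb_lt; lra.
  - apply Rmin_l.
  - intros x Hx. apply is_derive_cos_comp, Td; auto; lra.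
  - intros x Hx Hcos. rewrite rhs_order_param. specialize (HR x Hx).
    set (R := order_param N (th x)) in *. set (s := sin (th x i)).
    assert (Hs2 : 1 - c ^ 2 <= s ^ 2).
    { unfold s. rewrite sin_sqr_cos_sqr.
      assert (cos (th x i) ^ 2 <= c ^ 2); [|lra].
      rewrite <- !Rsqr_pow2. apply Rsqr_le_abs_1. rewrite (Rabs_pos_eq c) by lra.
      apply Rabs_le. split; [lra|]. eapply Rle_trans; [apply Hcos|apply Rmin_r]. }
    (* Compared as squares: [M^2 = ka^2 c^2 (1 - c^2)], with [R >= c] and [s^2 >= 1 - c^2]. *)
    assert (HRs : M <= ka * R * Rabs s).
    { apply Rsqr_incr_0_var.
      2:{ apply Rmult_le_pos; [apply Rmult_le_pos; lra|apply Rabs_pos]. }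
      rewrite !Rsqr_pow2, HM, !Rpow_mult_distr, pow2_abs, Rmult_assoc.
      apply Rmult_le_compat_l; [apply pow2_ge_0|].
      apply Rmult_le_compat; [apply pow2_ge_0| |apply pow_incr; lra|auto].
      assert (c ^ 2 <= 1 ^ 2) by (apply pow_incr; lra). lra. }
    assert (H1 : om i * s <= M * Rabs s).
    { eapply Rle_trans; [apply Rle_abs|]. apply Rabs_mult_le; auto; lra. }
    assert (H2 : M * Rabs s <= ka * R * Rabs s * Rabs s)
      by (apply Rmult_le_compat_r; [apply Rabs_pos|auto]).
    assert (H3 : Rabs s * Rabs s = s * s) by (rewrite <- Rabs_mult; apply Rabs_pos_eq, Rle_0_sqr).
    rewrite Rmult_assoc, H3 in H2. lra.
Qed.

(** A continuity argument at the first time [s] with [R <= c]: before [s] the cosine bound is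
    available, and its average at [s] gives [R > 1 - (1 - c) = c]. *)
Lemma order_param_stays_high N om ka th M c t0 : (1 <= N)%nat -> 0 < ka -> threshold M ka c ->
  (forall i, (i < N)%nat -> Rabs (om i) <= M) -> trajectory N om ka th -> 0 < t0 ->
  1 < order_param N (th t0) -> forall t, t0 <= t -> c < order_param N (th t).
Proof.
  intros HN Hka Hth Hom T Ht0 HR0 t Ht.
  destruct (Rlt_dec c (order_param N (th t))) as [|Hn]; auto. exfalso.
  assert (Hc := proj1 Hth).
  destruct (first_time (fun s => order_param N (th s)) c t0 t) as [s [Hs1 [Hs2 Hs3]]]; auto; try lra.
  { apply (order_param_continuous N om ka); auto. }
  assert (H : order_param N (th t0) - (1 - c) <= order_param N (th s)); [|lra].
  assert (E : order_param N (th t0) - (1 - c) =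
    / INR N * rsum N (fun j => 1 + cos (th t0 j) - (1 - c))).
  { unfold order_param. rewrite rsum_minus, rsum_const. field.
    assert (0 < INR N) by (apply lt_0_INR; lia). lra. }
  rewrite E. unfold order_param. apply Rmult_le_compat_l.
  { left; apply Rinv_0_lt_compat, lt_0_INR; lia. }
  apply rsum_le. intros j Hj.
  assert (Hcj := cos_lower_bound N om ka th M c j t0 s Hka Hth Hj (Hom j Hj) T ltac:(lra)).
  assert (cos (th t0 j) - (1 - c) <= cos (th s j)); [|lra].
  apply Hcj. intros u Hu. left; apply Hs3; lra.
Qed.

(** Both factors are at least [1 / sqrt 2]; this fixes the width [PI / 4] of the strips in
    [angles_bounded]. *)
Lemma half_le_mult_cos c x : 0 < c -> 1 / 2 < c ^ 2 -> 0 <= x <= PI / 4 -> 1 / 2 <= c * cos x.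
Proof.
  intros Hc Hc2 Hx. assert (HP := PI_RGT_0).
  assert (H1 : cos (PI / 4) <= cos x) by (apply cos_decr_1; lra).
  assert (H2 : 0 < cos (PI / 4)) by (apply cos_gt_0; lra).
  assert (H3 : cos (PI / 4) * cos (PI / 4) = 1 / 2).
  { rewrite cos_PI4. assert (E := sqrt_sqrt 2 ltac:(lra)).
    assert (0 < sqrt 2) by (apply sqrt_lt_R0; lra).
    replace (1 / sqrt 2 * (1 / sqrt 2)) with (1 / (sqrt 2 * sqrt 2)) by (field; lra).
    rewrite E; auto. }
  assert (H4 : 1 / 2 <= cos x * cos x) by (rewrite <- H3; apply Rmult_le_compat; lra).
  apply Rsqr_incr_0_var; [|apply Rmult_le_pos; lra].
  replace (c * cos x)² with (c ^ 2 * (cos x * cos x)) by (unfold Rsqr; ring).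
  replace (1 / 2)² with (1 / 2 * (1 / 2)) by (unfold Rsqr; ring).
  apply Rmult_le_compat; lra.
Qed.

(** Within [PI / 4] beyond [PI / 2] modulo [2 pi] the damping is at least [ka / 2 > M], so the angle
    cannot increase there; symmetrically beyond [- PI / 2]. The levels [top] and [bot] enclose the
    position at time [t0]. *)
Lemma angles_bounded N om ka th M c t0 i : 0 < ka -> 0 <= M -> 2 * M < ka -> threshold M ka c ->
  (i < N)%nat -> Rabs (om i) <= M -> trajectory N om ka th -> 0 < t0 ->
  (forall t, t0 <= t -> c < order_param N (th t)) ->
  exists B, forall t, t0 <= t -> Rabs (th t i) <= B.
Proof.
  intros Hka HM0 HM [Hc [Hc2 _]] Hi Hom [Tc Td] Ht0 HR. assert (HP := PI_RGT_0).
  set (p := period_index (th t0 i)).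
  assert (Hp : 0 <= th t0 i + 2 * PI * IZR p < 2 * PI) by apply period_index_spec.
  set (top := PI / 2 + 2 * PI * IZR (1 - p)).
  set (bot := - (PI / 2) + 2 * PI * IZR (- p)).
  assert (Hom' := Hom). apply Rabs_le_between in Hom'.
  assert (Htb : bot <= th t0 i <= top).
  { unfold top, bot. rewrite minus_IZR, opp_IZR. lra. }
  assert (Hbig : forall x t, t0 <= t -> 0 <= x <= PI / 4 ->
    M <= ka * order_param N (th t) * cos x).
  { intros x t Ht Hx. specialize (HR t Ht).
    assert (Hcx := half_le_mult_cos c x (proj1 Hc) Hc2 Hx).
    assert (Hcos : 0 < cos x) by (apply cos_gt_0; lra).
    assert (c * cos x <= order_param N (th t) * cos x) by (apply Rmult_le_compat_r; lra).
    assert (ka * (1 / 2) <= ka * (order_param N (th t) * cos x))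
      by (apply Rmult_le_compat_l; lra). lra. }
  assert (Hup : forall t, t0 <= t -> th t i <= top).
  { intros t Ht. apply Ropp_le_cancel.
    apply (barrier (fun s => - th s i) (fun s => - winfree_rhs N om ka (th s) i) t0 t
      (- top - PI / 4) (- top)); try lra.
    - intros x. apply (continuity_pt_opp (fun s => th s i)). auto.
    - intros x Hx. apply (is_derive_opp (fun s => th s i)), Td; auto; lra.
    - intros x Hx Hth. rewrite rhs_order_param.
      assert (E : sin (th x i) = cos (th x i - top)).
      { rewrite cos_sin. replace (PI / 2 + (th x i - top)) with (th x i + 2 * PI * IZR (- (1 - p))).
        - symmetry; apply sin_cos_period_Z.
        - unfold top. rewrite opp_IZR. ring. }
      rewrite E. specialize (Hbig (th x i - top) x ltac:(lra) ltac:(lra)). lra. }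
  assert (Hdown : forall t, t0 <= t -> bot <= th t i).
  { intros t Ht.
    apply (barrier (fun s => th s i) (fun s => winfree_rhs N om ka (th s) i) t0 t
      (bot - PI / 4) bot); try lra; auto.
    - intros x Hx. apply Td; auto; lra.
    - intros x Hx Hth. rewrite rhs_order_param.
      assert (E : sin (th x i) = - cos (bot - th x i)).
      { rewrite cos_sin, <- sin_neg.
        replace (- (PI / 2 + (bot - th x i))) with (th x i + 2 * PI * IZR p).
        - symmetry; apply sin_cos_period_Z.
        - unfold bot. rewrite opp_IZR. ring. }
      rewrite E. specialize (Hbig (bot - th x i) x ltac:(lra) ltac:(lra)). lra. }
  exists (Rmax (Rabs top) (Rabs bot)). intros t Ht.
  specialize (Hup t Ht). specialize (Hdown t Ht).
  assert (H1 := Rmax_l (Rabs top) (Rabs bot)). assert (H2 := Rmax_r (Rabs top) (Rabs bot)).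
  assert (H3 := Rle_abs top). assert (H4 := Rabs_maj2 bot).
  apply Rabs_le. lra.
Qed.

(** * The gradient structure and the decay of speeds *)

Lemma is_derive_rsum N (f : R -> nat -> R) (l : nat -> R) t :
  (forall j, (j < N)%nat -> is_derive (fun s => f s j) t (l j)) ->
  is_derive (fun s => rsum N (f s)) t (rsum N l).
Proof.
  induction N; intros H; simpl.
  - apply (@is_derive_const R_AbsRing R_NormedModule).
  - apply (is_derive_plus (fun s => rsum N (f s)) (fun s => f s N)); auto.
Qed.

(** The Winfree field is the gradient of this function, so along a trajectory it grows at the rate
    of the sum of squared speeds. Only its linear part can be unbounded, which is why the angles are
    trapped beforehand. *)
Definition potential (N : nat) (om : nat -> R) (ka : R) (th : nat -> R) : R :=
  rsum N (fun j => om j * th j) + ka * INR N / 2 * order_param N th ^ 2.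

Lemma potential_derive N om ka th t : (1 <= N)%nat -> trajectory N om ka th -> 0 < t ->
  is_derive (fun s => potential N om ka (th s)) t
    (rsum N (fun j => winfree_rhs N om ka (th t) j ^ 2)).
Proof.
  intros HN [_ Td] Ht. assert (HN' : 0 < INR N) by (apply lt_0_INR; lia).
  set (V := fun j => winfree_rhs N om ka (th t) j).
  assert (H1 : is_derive (fun s => rsum N (fun j => om j * th s j)) t (rsum N (fun j => om j * V j))).
  { apply (is_derive_rsum N (fun s j => om j * th s j)). intros j Hj.
    apply (is_derive_scal (fun s => th s j)). apply Td; auto. }
  assert (H2 : is_derive (fun s => order_param N (th s)) t
    (/ INR N * rsum N (fun j => - sin (th t j) * V j))).
  { unfold order_param. apply (is_derive_scal (fun s => rsum N (fun j => 1 + cos (th s j)))).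
    apply (is_derive_rsum N (fun s j => 1 + cos (th s j))). intros j Hj.
    rewrite <- (Rplus_0_l (- sin (th t j) * V j)).
    apply (is_derive_plus (fun _ => 1) (fun s => cos (th s j))).
    - apply (@is_derive_const R_AbsRing R_NormedModule).
    - apply is_derive_cos_comp, Td; auto. }
  assert (H3 := is_derive_pow (fun s => order_param N (th s)) 2 t _ H2).
  assert (H4 := is_derive_scal _ t (ka * INR N / 2) _ H3).
  assert (H5 := is_derive_plus _ _ t _ _ H1 H4).
  eapply is_derive_ext; [|eapply eq_rect; [exact H5|]].
  - intros s; reflexivity.
  - simpl. unfold plus; simpl.
    set (R := order_param N (th t)).
    rewrite (rsum_ext N (fun j => V j * (V j * 1))
      (fun j => om j * V j + ka * R * (- sin (th t j) * V j))).
    + rewrite rsum_plus, rsum_scal. field. lra.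
    + intros j Hj. unfold V at 1. rewrite rhs_order_param. fold R. ring.
Qed.

(** The potential increases to a finite limit [l]. A speed above [eps] at time [t] stays above
    [eps / 2] for a time [tau], which would raise the potential by [d], impossible once it exceeds
    [l - d]. *)
Lemma speed_vanishes N om ka th t0 B i : (1 <= N)%nat -> 0 < ka -> trajectory N om ka th -> 0 < t0 ->
  (forall j t, (j < N)%nat -> t0 <= t -> Rabs (th t j) <= B) -> (i < N)%nat ->
  forall eps, 0 < eps -> exists T, t0 <= T /\
    forall t, T <= t -> Rabs (winfree_rhs N om ka (th t) i) <= eps.
Proof.
  intros HN Hka Tr Ht0 HB Hi eps Heps.
  assert (HN' : 0 < INR N) by (apply lt_0_INR; lia).
  set (F := fun t => potential N om ka (th t)).
  set (V := fun t j => winfree_rhs N om ka (th t) j).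
  assert (HF : forall t, 0 < t -> is_derive F t (rsum N (fun j => V t j ^ 2)))
    by (intros; apply potential_derive; auto).
  assert (HFd : forall s t, t0 <= s -> s < t -> exists x, s < x < t /\
     F t - F s = rsum N (fun j => V x j ^ 2) * (t - s)).
  { intros s t Hs Hst. apply (mean_value_lt F (fun x => rsum N (fun j => V x j ^ 2))); auto.
    - intros; apply HF; lra.
    - intros x Hx. apply derivable_continuous_pt. exists (rsum N (fun j => V x j ^ 2)).
      apply is_derive_Reals, HF; lra. }
  assert (HV2 : forall x, 0 <= rsum N (fun j => V x j ^ 2))
    by (intros; apply rsum_nonneg; intros; apply pow2_ge_0).
  assert (HFm : forall s t, t0 <= s -> s <= t -> F s <= F t).
  { intros s t Hs [Hst|<-]; [|lra]. destruct (HFd s t Hs Hst) as [x [_ E]].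
    assert (0 <= rsum N (fun j => V x j ^ 2) * (t - s)) by (apply Rmult_le_pos; auto; lra). lra. }
  destruct (completeness (fun v => exists t, t0 <= t /\ v = F t)) as [l [Hl1 Hl2]].
  { exists (rsum N (fun j => Rabs (om j) * B) + ka * INR N / 2 * 4). intros v [t [Ht ->]].
    unfold F, potential. apply Rplus_le_compat.
    - apply rsum_le. intros j Hj. eapply Rle_trans; [apply Rle_abs|].
      apply Rabs_mult_le; [lra|auto].
    - apply Rmult_le_compat_l.
      + assert (0 < ka * INR N) by (apply Rmult_lt_0_compat; auto). lra.
      + destruct (order_param_bounds N (th t) HN).
        replace 4 with (2 ^ 2) by ring. apply pow_incr; lra. }
  { exists (F t0), t0; split; [lra|auto]. }
  set (W := rsum N (fun j => Rabs (om j)) + 2 * ka).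
  assert (HW : 0 < W).
  { unfold W. assert (0 <= rsum N (fun j => Rabs (om j))); [|lra].
    apply rsum_nonneg; intros; apply Rabs_pos. }
  (* Angles move at speed at most [W] and the field is [3 ka]-Lipschitz, so a speed changes by at
     most [eps / 2] during [tau]. *)
  set (tau := eps / (6 * ka * W)).
  assert (HkW : 0 < 6 * ka * W) by (repeat apply Rmult_lt_0_compat; lra).
  assert (Htau : 0 < tau) by (apply Rdiv_lt_0_compat; auto).
  assert (Htau' : 3 * ka * (W * tau) = eps / 2) by (unfold tau; field; lra).
  set (d := (eps / 2) ^ 2 * tau).
  assert (Hd : 0 < d) by (apply Rmult_lt_0_compat; auto; apply pow_lt; lra).
  assert (HT : exists T, t0 <= T /\ l - d < F T).
  { apply NNPP. intros Hn. assert (l <= l - d); [|lra]. apply Hl2. intros v [t [Ht ->]].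
    destruct (Rle_dec (F t) (l - d)); auto. exfalso; apply Hn; exists t; split; auto; lra. }
  destruct HT as [T [HT1 HT2]]. exists T; split; auto. intros t Ht.
  destruct (Rle_dec (Rabs (V t i)) eps) as [|Hn]; auto. exfalso.
  assert (H1 : F T <= F t) by (apply HFm; auto).
  assert (H2 : F (t + tau) <= l) by (apply Hl1; exists (t + tau); split; [lra|auto]).
  destruct (HFd t (t + tau)) as [x [Hx E]]; [lra|lra|].
  assert (Hvx : Rabs (V x i - V t i) <= 3 * ka * (W * tau)).
  { apply rhs_lip; auto. intros j Hj.
    eapply Rle_trans; [apply (trajectory_speed N om ka th j t x); auto; lra|].
    fold W. apply Rmult_le_compat_l; [lra|]. apply Rabs_le; lra. }
  assert (Hvx' : eps / 2 <= Rabs (V x i)).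
  { rewrite Rabs_minus_sym in Hvx. generalize (Rabs_triang_inv (V t i) (V x i)); lra. }
  assert (Hs : (eps / 2) ^ 2 <= rsum N (fun j => V x j ^ 2)).
  { apply Rle_trans with (V x i ^ 2).
    - rewrite <- (pow2_abs (V x i)). apply pow_incr; lra.
    - apply (rsum_term N (fun j => V x j ^ 2)); auto. intros; apply pow2_ge_0. }
  assert (Hfin : d <= rsum N (fun j => V x j ^ 2) * tau) by (apply Rmult_le_compat_r; lra).
  replace (t + tau - t) with tau in E by ring. lra.
Qed.

(* A continuous angle that avoids the arcs [|cos| < 1/sqrt 2] stays in one arc, on which
   [sin] is injective with slope at least [1/sqrt 2]. *)
Lemma arc_estimate (f : R -> R) T s t : (forall x, continuity_pt f x) ->
  (forall x, T <= x -> sin (f x) ^ 2 <= 1 / 2) -> T <= s -> T <= t ->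
  Rabs (f t - f s) <= 2 * Rabs (sin (f t) - sin (f s)) /\
  Rabs (cos (f t) - cos (f s)) <= Rabs (sin (f t) - sin (f s)).
Proof.
  intros Hc Hs HTs HTt.
  (* By the intermediate value theorem every angle between [f s] and [f t] is taken at a time after
     [T], so the bound on [sin^2] holds on the whole segment. *)
  assert (Hbetween : forall y, Rmin (f s) (f t) <= y <= Rmax (f s) (f t) -> sin y ^ 2 <= 1 / 2).
  { intros y Hy. destruct (IVT_gen f s t y) as [x [Hx <-]]; auto.
    apply Hs. unfold Rmin in Hx. destruct Rle_dec; lra. }
  set (D := f t - f s).
  assert (H1 : D ^ 2 <= 2 * (sin (f t) - sin (f s)) ^ 2).
  { destruct (sin_diff (f s) (f t)) as [y [Hy ->]]. fold D.
    specialize (Hbetween y Hy). rewrite sin_sqr_cos_sqr in Hbetween.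
    rewrite Rpow_mult_distr.
    assert (1 / 2 * D ^ 2 <= cos y ^ 2 * D ^ 2)
      by (apply Rmult_le_compat_r; [apply pow2_ge_0|lra]). lra. }
  assert (H2 : 2 * (cos (f t) - cos (f s)) ^ 2 <= D ^ 2).
  { destruct (cos_diff (f s) (f t)) as [y [Hy ->]]. fold D.
    specialize (Hbetween y Hy). rewrite Rpow_mult_distr.
    replace ((- sin y) ^ 2) with (sin y ^ 2) by ring.
    assert (sin y ^ 2 * D ^ 2 <= 1 / 2 * D ^ 2)
      by (apply Rmult_le_compat_r; [apply pow2_ge_0|lra]). lra. }
  split.
  - rewrite <- (Rabs_pos_eq 2), <- Rabs_mult by lra. apply Rsqr_le_abs_0.
    rewrite !Rsqr_pow2, Rpow_mult_distr.
    generalize (pow2_ge_0 (sin (f t) - sin (f s))); simpl in *; lra.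
  - apply Rsqr_le_abs_0. rewrite !Rsqr_pow2. lra.
Qed.

(** * Convergence from the Cauchy criterion *)

Lemma eventually_uniform N (P : nat -> R -> Prop) t0 :
  (forall i, (i < N)%nat -> exists T, t0 <= T /\ forall t, T <= t -> P i t) ->
  exists T, t0 <= T /\ forall i t, (i < N)%nat -> T <= t -> P i t.
Proof.
  induction N; intros H.
  - exists t0; split; [lra|]. intros; lia.
  - destruct IHN as [T1 [H1 H1']]; [intros; apply H; lia|].
    destruct (H N (Nat.lt_succ_diag_r N)) as [T2 [H2 H2']].
    assert (HL := Rmax_l T1 T2). assert (HRr := Rmax_r T1 T2).
    exists (Rmax T1 T2). split; [lra|]. intros i t Hi Ht.
    destruct (Nat.eq_dec i N) as [->|]; [apply H2'; lra|apply H1'; [lia|lra]].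
Qed.

Lemma is_lim_of_cauchy (f : R -> R) :
  (forall eps, 0 < eps -> exists T, forall s t, T <= s -> T <= t -> Rabs (f t - f s) <= eps) ->
  exists L : R, is_lim f p_infty L.
Proof.
  intros H.
  destruct (proj1 (@filterlim_locally_cauchy R R_CompleteSpace (Rbar_locally' p_infty) _ f)) as [L HL].
  { intros eps.
    destruct (H (eps / 2)) as [T HT]; [generalize (cond_pos eps); lra|].
    exists (fun t => T < t). split; [exists T; auto|]. intros u v Hu Hv.
    assert (Huv := HT u v ltac:(lra) ltac:(lra)).
    unfold ball; simpl; unfold AbsRing_ball, abs, minus, plus, opp; simpl.
    unfold Rminus in Huv. generalize (cond_pos eps); lra. }
  exists L. exact HL.
Qed.

Lemma high_trajectory_converges N om ka th M c t0 : (1 <= N)%nat -> 0 < ka -> 0 <= M ->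
  2 * M < ka -> threshold M ka c -> (forall i, (i < N)%nat -> Rabs (om i) <= M) ->
  trajectory N om ka th -> 0 < t0 -> 1 < order_param N (th t0) ->
  (forall i, (i < N)%nat -> (exists L : R, is_lim (fun t => th t i) p_infty L) /\
     is_lim (fun t => winfree_rhs N om ka (th t) i) p_infty 0) /\
  exists Rinf : R, is_lim (fun t => order_param N (th t)) p_infty Rinf /\ c <= Rinf.
Proof.
  intros HN Hka HM0 HM Hth Hom Tr Ht0 HR0.
  assert (HR := order_param_stays_high N om ka th M c t0 HN Hka Hth Hom Tr Ht0 HR0).
  assert (HB : exists B, forall j t, (j < N)%nat -> t0 <= t -> Rabs (th t j) <= B).
  { assert (H : forall n, (n <= N)%nat ->
      exists B, forall j t, (j < n)%nat -> t0 <= t -> Rabs (th t j) <= B).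
    { induction n; intros Hn; [exists 0; intros; lia|].
      destruct IHn as [B1 H1]; [lia|].
      destruct (angles_bounded N om ka th M c t0 n) as [B2 H2]; auto.
      exists (Rmax B1 B2). intros j t Hj Ht. destruct (Nat.eq_dec j n) as [->|].
      - eapply Rle_trans; [apply H2; auto|apply Rmax_r].
      - eapply Rle_trans; [apply H1; auto; lia|apply Rmax_l]. }
    apply H; auto. }
  destruct HB as [B HB].
  assert (HV : forall eps, 0 < eps -> exists T, t0 <= T /\ forall i t, (i < N)%nat -> T <= t ->
    Rabs (winfree_rhs N om ka (th t) i) <= eps).
  { intros eps Heps. apply eventually_uniform. intros i Hi.
    apply (speed_vanishes N om ka th t0 B); auto. }
  destruct Hth as [Hc [Hc2 _]].
  (* With this speed bound [ka R |sin| <= M + (ka - 2 M) / 2 = ka / 2]; then [c^2 sin^2 <= 1/4], and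
     [c^2 > 1/2] gives [sin^2 <= 1/2]. *)
  destruct (HV ((ka - 2 * M) / 2)) as [T1 [HT1 HV1]]; [lra|].
  assert (Hsin : forall i, (i < N)%nat -> forall t, T1 <= t -> sin (th t i) ^ 2 <= 1 / 2).
  { intros i Hi t Ht. specialize (HV1 i t Hi Ht). rewrite rhs_order_param in HV1.
    specialize (HR t ltac:(lra)). set (R := order_param N (th t)) in *.
    set (s := sin (th t i)) in *.
    assert (Hs : ka * R * Rabs s <= ka * (1 / 2)).
    { replace (ka * R * Rabs s) with (Rabs (ka * R * s)).
      2:{ rewrite Rabs_mult, (Rabs_pos_eq (ka * R)); auto. apply Rmult_le_pos; lra. }
      replace (ka * R * s) with (om i - (om i - ka * R * s)) by ring.
      unfold Rminus at 1. eapply Rle_trans; [apply Rabs_triang|]. rewrite Rabs_Ropp.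
      specialize (Hom i Hi). lra. }
    rewrite Rmult_assoc in Hs. apply Rmult_le_reg_l in Hs; auto.
    assert (Hs0 := Rabs_pos s).
    assert (Hcs : c * Rabs s <= 1 / 2).
    { eapply Rle_trans; [|exact Hs]. apply Rmult_le_compat_r; lra. }
    assert (Hcs2 : c ^ 2 * s ^ 2 <= 1 / 4).
    { rewrite <- (pow2_abs s), <- Rpow_mult_distr. replace (1 / 4) with ((1 / 2) ^ 2) by field.
      apply pow_incr; split; auto. apply Rmult_le_pos; lra. }
    assert (1 / 2 * s ^ 2 <= c ^ 2 * s ^ 2) by (apply Rmult_le_compat_r; [apply pow2_ge_0|lra]).
    lra. }
  (* equilibrium relation [ka R sin = om - speed], compared at two times *)
  assert (Hcomp : forall e T, 0 < e -> T1 <= T -> (forall i t, (i < N)%nat -> T <= t ->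
      Rabs (winfree_rhs N om ka (th t) i) <= e) -> forall s t, T <= s -> T <= t ->
      (ka - 2 * M) * Rabs (order_param N (th t) - order_param N (th s)) <= 8 * e /\
      forall i, (i < N)%nat -> Rabs (th t i - th s i) <=
        2 * (Rabs (order_param N (th t) - order_param N (th s)) + 8 * e / ka)).
  { intros e T He HT Hve s t Hs Ht.
    assert (HRs := HR s ltac:(lra)). assert (HRt := HR t ltac:(lra)).
    destruct (order_param_bounds N (th s) HN) as [_ HRs2].
    destruct (order_param_bounds N (th t) HN) as [_ HRt2].
    set (Rs := order_param N (th s)) in *. set (Rt := order_param N (th t)) in *.
    assert (Hdsin : forall i, (i < N)%nat ->
      ka * Rabs (sin (th t i) - sin (th s i)) <= 2 * M * Rabs (Rt - Rs) + 8 * e).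
    { intros i Hi. assert (Hvs := Hve i s Hi Hs). assert (Hvt := Hve i t Hi Ht).
      assert (Es := rhs_order_param N om ka (th s) i). fold Rs in Es.
      assert (Et := rhs_order_param N om ka (th t) i). fold Rt in Et.
      set (vs := winfree_rhs N om ka (th s) i) in *.
      set (vt := winfree_rhs N om ka (th t) i) in *.
      set (D := sin (th t i) - sin (th s i)).
      (* Cross-multiplying the two relations by [Rs] and [Rt] isolates the difference of the sines.
         Since [Rs * Rt >= c^2 > 1/2], dividing by it at most doubles the right side, and [R <= 2]
         accounts for [8 e]. *)
      assert (E : ka * (Rs * Rt) * D = om i * (Rs - Rt) + (Rt * vs + - (Rs * vt)))
        by (unfold D; rewrite Es, Et; ring).
      assert (HRR : 1 / 2 <= Rs * Rt).
      { apply Rle_trans with (c * c); [simpl in Hc2; lra|]. apply Rmult_le_compat; lra. }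
      assert (H1 : Rabs (ka * (Rs * Rt) * D) <= M * Rabs (Rt - Rs) + (2 * e + 2 * e)).
      { rewrite E. eapply Rle_trans; [apply Rabs_triang|]. apply Rplus_le_compat.
        - rewrite (Rabs_minus_sym Rt). apply Rabs_mult_le; auto; lra.
        - eapply Rle_trans; [apply Rabs_triang|]. rewrite Rabs_Ropp.
          apply Rplus_le_compat; apply Rabs_mult_le; auto; rewrite Rabs_pos_eq; lra. }
      rewrite Rabs_mult in H1. rewrite (Rabs_pos_eq (ka * (Rs * Rt))) in H1
        by (apply Rmult_le_pos; lra).
      assert (H2 : ka * (1 / 2) * Rabs D <= ka * (Rs * Rt) * Rabs D).
      { apply Rmult_le_compat_r; [apply Rabs_pos|]. apply Rmult_le_compat_l; lra. }
      lra. }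
    (* The change of [R] is the mean change of the cosines, each at most the change of the
       corresponding sine. *)
    assert (Hdc : ka * Rabs (Rt - Rs) <= 2 * M * Rabs (Rt - Rs) + 8 * e).
    { rewrite Rmult_comm.
      apply (Rmult_le_reg_r (/ ka)); [apply Rinv_0_lt_compat; auto|].
      rewrite Rmult_assoc, Rinv_r, Rmult_1_r by lra. unfold Rt at 1, Rs at 1.
      rewrite order_param_diff. apply mean_abs_le; auto. intros j Hj.
      destruct (arc_estimate (fun x => th x j) T1 s t) as [_ Harc]; auto; try lra.
      { apply Tr; auto. }
      eapply Rle_trans; [exact Harc|]. apply (Rmult_le_reg_l ka); auto.
      replace (ka * ((2 * M * Rabs (Rt - Rs) + 8 * e) * / ka))
        with (2 * M * Rabs (Rt - Rs) + 8 * e) by (field; lra). auto. }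
    split; [lra|]. intros i Hi.
    destruct (arc_estimate (fun x => th x i) T1 s t) as [Harc _]; auto; try lra.
    { apply Tr; auto. }
    eapply Rle_trans; [exact Harc|]. apply Rmult_le_compat_l; [lra|].
    apply (Rmult_le_reg_l ka); auto.
    replace (ka * (Rabs (Rt - Rs) + 8 * e / ka)) with (ka * Rabs (Rt - Rs) + 8 * e)
      by (field; lra).
    eapply Rle_trans; [apply Hdsin; auto|]. apply Rplus_le_compat_r.
    apply Rmult_le_compat_r; [apply Rabs_pos|lra]. }
  assert (Hcauchy : forall eps, 0 < eps -> exists T, T1 <= T /\ forall s t, T <= s -> T <= t ->
     Rabs (order_param N (th t) - order_param N (th s)) <= eps /\
     forall i, (i < N)%nat -> Rabs (th t i - th s i) <= eps).
  { intros eps Heps. set (e := (ka - 2 * M) * eps / 32).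
    assert (He : 0 < e) by (unfold e; assert (0 < (ka - 2 * M) * eps)
      by (apply Rmult_lt_0_compat; lra); lra).
    destruct (HV e He) as [T2 [HT2 HV2]].
    assert (HL := Rmax_l T1 T2). assert (HRr := Rmax_r T1 T2).
    exists (Rmax T1 T2). split; auto. intros s t Hs Ht.
    destruct (Hcomp e (Rmax T1 T2) He HL) with (s := s) (t := t) as [H1 H2]; auto.
    { intros; apply HV2; auto; lra. }
    assert (H3 : Rabs (order_param N (th t) - order_param N (th s)) <= eps / 4).
    { apply (Rmult_le_reg_l (ka - 2 * M)); [lra|]. unfold e in H1. lra. }
    split; [lra|]. intros i Hi. specialize (H2 i Hi).
    assert (H4 : 8 * e / ka <= eps / 4).
    { apply (Rmult_le_reg_l ka); auto. replace (ka * (8 * e / ka)) with (8 * e) by (field; lra).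
      unfold e. assert (0 <= M * eps) by (apply Rmult_le_pos; lra). lra. }
    lra. }
  split.
  - intros i Hi. split.
    + apply is_lim_of_cauchy. intros eps Heps. destruct (Hcauchy eps Heps) as [T [_ H]].
      exists T. intros s t Hs Ht. apply H; auto.
    + apply is_lim_spec. intros eps. destruct (HV (eps / 2)) as [T [_ H]].
      { generalize (cond_pos eps); lra. }
      exists T. intros t Ht. rewrite Rminus_0_r. specialize (H i t Hi ltac:(lra)).
      generalize (cond_pos eps); lra.
  - destruct (is_lim_of_cauchy (fun t => order_param N (th t))) as [L HL].
    + intros eps Heps. destruct (Hcauchy eps Heps) as [T [_ H]].
      exists T. intros s t Hs Ht. apply H; auto.
    + exists L; split; auto.
      apply (is_lim_le_loc (fun _ => c) (fun t => order_param N (th t)) p_infty c L); auto.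
      * exists t0. intros t Ht. left; apply HR; lra.
      * apply is_lim_const.
Qed.

Lemma rmaxabs_bound N w i : (i < N)%nat -> Rabs (w i) <= rmaxabs N w.
Proof.
  induction N; intros Hi; [lia|]. simpl. destruct (Nat.eq_dec i N) as [->|]; [apply Rmax_r|].
  eapply Rle_trans; [apply IHN; lia|apply Rmax_l].
Qed.

Lemma rmaxabs_nonneg N w : 0 <= rmaxabs N w.
Proof.
  induction N; simpl; [lra|]. eapply Rle_trans; [exact IHN|apply Rmax_l].
Qed.

(* A solution is only constrained for [t >= 0]; freezing it for [t <= 0] makes it continuous. *)
Lemma solution_extend N om ka x th : winfree_solution N om ka x th ->
  exists th', trajectory N om ka th' /\ (forall i, (i < N)%nat -> th' 0 i = x i) /\
    forall t, 0 < t -> th' t = th t.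
Proof.
  intros [H0 [Hr Hd]].
  set (th' := fun t => if Rle_dec t 0 then x else th t).
  assert (Hpos : forall t, 0 < t -> th' t = th t).
  { intros t Ht. unfold th'. destruct Rle_dec; auto; lra. }
  assert (Hneg : forall t, t <= 0 -> th' t = x).
  { intros t Ht. unfold th'. destruct Rle_dec; auto; lra. }
  assert (Hder : forall t, 0 < t -> forall i, (i < N)%nat ->
     is_derive (fun s => th' s i) t (winfree_rhs N om ka (th' t) i)).
  { intros t Ht i Hi. rewrite Hpos by auto.
    apply (is_derive_ext_loc (fun s => th s i)); [|apply Hd; auto].
    exists (mkposreal t Ht). intros s Hs. rewrite Hpos; auto.
    unfold ball in Hs; simpl in Hs; unfold AbsRing_ball, abs, minus, plus, opp in Hs; simpl in Hs.
    apply Rabs_lt_between in Hs. lra. }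
  exists th'. split; [split; auto|split; auto].
  - intros i Hi t. destruct (Rlt_le_dec 0 t) as [Ht|Ht].
    + apply derivable_continuous_pt. eexists. apply is_derive_Reals, Hder; auto.
    + apply continuity_pt_filterlim. apply filterlim_locally. intros eps.
      rewrite Hneg by auto. destruct Ht as [Ht| ->].
      * assert (Ht' : 0 < - t) by lra. exists (mkposreal (- t) Ht'). intros s Hs.
        unfold ball in Hs; simpl in Hs; unfold AbsRing_ball, abs, minus, plus, opp in Hs; simpl in Hs.
        apply Rabs_lt_between in Hs. rewrite Hneg by lra. apply ball_center.
      * specialize (Hr i Hi). rewrite filterlim_locally in Hr. destruct (Hr eps) as [d Hdd].
        exists d. intros s Hs. destruct (Rlt_le_dec 0 s) as [Hs0|Hs0].
        -- rewrite Hpos by auto. apply Hdd; auto.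
        -- rewrite Hneg by auto. apply ball_center.
  - intros i Hi. rewrite Hneg; auto; lra.
Qed.

Theorem theorem1p1 (N : nat) (omega : nat -> R) (kappa : R) :
  (1 <= N)%nat ->
  0 < kappa ->
  kappa > 2 * rmaxabs N omega ->
  exists E : (nat -> R) -> Prop,
    lebesgue_null N E /\
    forall x : nat -> R, ~ E x ->
    forall theta : R -> nat -> R,
      winfree_solution N omega kappa x theta ->
      (forall i, (i < N)%nat ->
         (exists L : R, is_lim (fun t => theta t i) p_infty L) /\
         is_lim (fun t => Derive (fun s => theta s i) t) p_infty 0) /\
      (exists Rinf : R,
         is_lim (fun t => order_param N (theta t)) p_infty Rinf /\
         Rinf >= sqrt (1/2 + sqrt (1/4 - (rmaxabs N omega)^2 / kappa^2))).
Proof.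
  intros HN Hka HM. assert (HM0 := rmaxabs_nonneg N omega).
  destruct (low_start_null N omega kappa HN Hka) as [E [HE1 HE2]].
  exists E; split; auto. intros x Hx theta Hsol.
  destruct (solution_extend N omega kappa x theta Hsol) as [th [Tr [H0 Hpos]]].
  (* If [R] never exceeded 1, the extended trajectory would make [x] a low start, contrary to the
     choice of [x] outside [E]. *)
  assert (Hhigh : exists t0, 0 < t0 /\ 1 < order_param N (th t0)).
  { apply NNPP. intros Hn. apply Hx, HE2. exists th. split; auto. split; auto.
    intros t Ht. apply Rnot_lt_le. intros H. apply Hn; eauto. }
  destruct Hhigh as [t0 [Ht0 HR0]].
  destruct (high_trajectory_converges N omega kappa th (rmaxabs N omega) _ t0 HN Hka HM0
    (Rgt_lt _ _ HM) (threshold_sqrt _ _ HM0 (Rgt_lt _ _ HM)) (rmaxabs_bound N omega) Tr Ht0 HR0)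
    as [Hlim [Rinf [HRinf HRc]]].
  assert (Hloc : forall f g : R -> R, (forall t, 0 < t -> f t = g t) ->
    forall l, is_lim f p_infty l -> is_lim g p_infty l).
  { intros f g Hfg l. apply is_lim_ext_loc. exists 0. auto. }
  split.
  - intros i Hi. destruct (Hlim i Hi) as [[L HL] HV]. split.
    + exists L. revert HL. apply Hloc. intros t Ht. rewrite Hpos; auto.
    + revert HV. apply Hloc. intros t Ht. rewrite Hpos by auto.
      symmetry. apply is_derive_unique, Hsol; auto.
  - exists Rinf. split; [|lra]. revert HRinf. apply Hloc. intros t Ht. rewrite Hpos; auto.
Qed.
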